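(* In the setting described in the context, let $e_1'$ be the eigenvalue parameter of the new pants curve (represented by $\gamma_3\gamma_4$) and $t_1',\dots,t_5'$ the new twist parameters after a type (V) move on a four-holed sphere. Then $e_1'$ is one of the solutions of $x^2-\operatorname{tr}(\rho(\gamma_3\gamma_4))x+1=0$, and $$\begin{aligned} t_1'=\ &\frac{1}{e_1'+e_1'^{-1}}\,\frac{e_1'e_5e_2}{(e_5e_2-e_1')(e_1'e_2-e_5)}\,\frac{e_1'e_3e_4}{(e_3e_4-e_1')(e_1'e_3-e_4)}\\ &\times\Bigl((e_1'-e_1'^{-1})\bigl(e_1'\operatorname{tr}\rho(\gamma_3\gamma_5)-e_1'^{-1}\operatorname{tr}\rho(\gamma_2\gamma_4)\bigr)\\ &\quad-(e_1'+e_1'^{-1})\bigl((e_2+e_2^{-1})(e_3+e_3^{-1})+(e_4+e_4^{-1})(e_5+e_5^{-1})\bigr)\\ &\quad+2\bigl((e_3+e_3^{-1})(e_5+e_5^{-1})+(e_2+e_2^{-1})(e_4+e_4^{-1})\bigr)\Bigr)\end{aligned}$$ (when $e_1'^2\neq-1$), or alternatively $$t_1'=\frac{(e_4e_1'-e_3)\bigl(e_3e_5(-(e_1e_3-e_2)t_1+e_1(e_1e_2-e_3))e_1'+e_1(e_1e_3-e_2)t_1-(e_1e_2-e_3)\bigr)}{(e_3e_1'-e_4)\bigl((e_1(e_1e_3-e_2)t_1-(e_1e_2-e_3))e_1'+e_3e_5(-(e_1e_3-e_2)t_1+e_1(e_1e_2-e_3))\bigr)},$$ and $$t_2'=\frac{(e_1e_2-e_3)(e_1e_3-e_2)(t_1+1)}{(e_2e_3-e_1)(e_1e_3-e_2)t_1+(1-e_1e_2e_3)(e_1e_2-e_3)}\cdot\frac{e_2e_1'-e_5}{e_2e_5-e_1'}\,t_2,$$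 $$t_3'=\frac{(e_2e_3-e_1)\bigl((e_1e_3-e_2)(e_1e_4-e_5)t_1+(e_1e_2-e_3)(e_1e_5-e_4)\bigr)}{(e_1e_3-e_2)\bigl((e_2e_3-e_1)(e_1e_4-e_5)t_1+(1-e_1e_2e_3)(e_1e_5-e_4)\bigr)}\,t_3,$$ $$t_4'=\frac{(e_1e_3-e_2)(e_1e_4-e_5)t_1+(e_1e_2-e_3)(e_1e_5-e_4)}{(e_1e_3-e_2)(e_4e_5-e_1)t_1+(e_1e_2-e_3)(1-e_1e_4e_5)}\cdot\frac{e_3e_1'-e_4}{1-e_3e_4e_1'}\,t_4,$$ $$t_5'=\frac{(e_1e_5-e_4)(e_1e_4e_5-1)(t_1+1)}{(e_1-e_4e_5)(e_1e_4-e_5)t_1+(e_1e_4e_5-1)(e_1e_5-e_4)}\,t_5.$$ No other parameter changes under the move. Here, with $s_i=e_i+e_i^{-1}$, $K=\frac{(e_2e_3-e_1)(e_1e_3-e_2)}{e_1e_2e_3}\cdot\frac{(e_4e_5-e_1)(e_1e_4-e_5)}{e_1e_4e_5}$ and $L=\frac{(1-e_1e_2e_3)(e_1e_2-e_3)}{e_1e_2e_3}\cdot\frac{(1-e_1e_4e_5)(e_1e_5-e_4)}{e_1e_4e_5}$, the traces are given by $$(e_1-e_1^{-1})^2\operatorname{tr}\rho(\gamma_3\gamma_4)=-Kt_1-L\,t_1^{-1}+s_1(s_3s_5+s_2s_4)-2(s_2s_5+s_3s_4),$$ $$(e_1-e_1^{-1})^2\operatorname{tr}\rho(\gamma_2\gamma_4)=K\,e_1t_1+L\,(e_1t_1)^{-1}+s_1(s_2s_5+s_3s_4)-2(s_2s_4+s_3s_5),$$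 $$(e_1-e_1^{-1})^2\operatorname{tr}\rho(\gamma_3\gamma_5)=K\,e_1^{-1}t_1+L\,e_1t_1^{-1}+s_1(s_2s_5+s_3s_4)-2(s_2s_4+s_3s_5).$$
   Context: General definitions. $S$ is a compact oriented surface with negative Euler characteristic. Pants decomposition: a disjoint union of simple closed curves cutting $S$ into pairs of pants; a pants curve is one of these curves or a boundary component. Dual graph: a graph embedded in $S$, all edges oriented, with only trivalent and univalent vertices, one trivalent vertex in each pair of pants, one univalent vertex on each component of $\partial S$, interior edges (both ends trivalent) crossing the pants decomposition exactly once transversely, boundary edges not crossing it. Edges correspond to pants curves. $\rho:\pi_1(S)\to\mathrm{SL}(2,\mathbb{C})$ satisfies: (C1) the image of each pants curve has exactly two fixed points on $\mathbb{C}P^1$; (C2) the restriction of $\rho$ to $\pi_1$ of each pair of pants is irreducible (no common fixed point in $\mathbb{C}P^1$); both are assumed for the old and for the new pants decomposition. Eigenvalue parameter of an edge: a chosen eigenvalue of $\rho$ of the corresponding pants curve (specified for the new curve below). Twist parameter of an interior edge $f$ from $v$ to $v'$: take the base point on $f$ where it crosses its pants curve $c$. Let $(f,h_2,h_3)$ be the half-edges at $v$ in counterclockwise order starting with the initial half of $f$, and $(f,h_4,h_5)$ those at $v'$ in counterclockwise order starting with the terminal half of $f$. For $i=2,3$ (resp. $4,5$), $\gamma_i$ is the loop going along $f$ to $v$ (resp. $v'$), along $h_i$ to the boundary component of the pair of pants, once around it counterclockwise (hole on the left) and back; $\gamma_1$ is the analogous loop around $c$ seen from $v$; then $\gamma_1\gamma_2\gamma_3=1=\gamma_1^{-1}\gamma_4\gamma_5$.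 For $i\ge2$, $x_i\in\mathbb{C}P^1$ is the fixed point of $\rho(\gamma_i)$ given by the eigenvector for the eigenvalue parameter $e$ of the edge containing $h_i$ if $h_i$ is outgoing, and for $e^{-1}$ if incoming; $x_1,y_1$ are the fixed points of $\rho(\gamma_1)$ for $e_f,e_f^{-1}$. The twist parameter $t_f\in\mathbb{C}^*$ is the unique number such that the matrix with eigenvalue $\sqrt{-t_f}$ at $x_1$ and $1/\sqrt{-t_f}$ at $y_1$ sends $x_2$ to $x_5$. Setting of the proposition. $f_1$ is an interior edge from $v$ to $v'\neq v$ with counterclockwise orders $(f_1,f_2,f_3)$ at $v$ and $(f_1,f_4,f_5)$ at $v'$, where $f_2,f_3,f_4,f_5$ are pairwise distinct interior edges oriented away from $v$ and $v'$. $e_i,t_i$ ($1\le i\le5$) are the parameters of $f_i$, and $\gamma_1,\dots,\gamma_5$ are the loops above for $f=f_1$ (so $\gamma_2\gamma_3\gamma_4\gamma_5=1$); $e_i$ is an eigenvalue of $\rho(\gamma_i)$. Type (V) move on the four-holed sphere $S'$ formed by the pairs of pants containing $v,v'$: the curve $c_1$ of $f_1$ is replaced by the curve $c_1'$ represented by $\gamma_3\gamma_4$, and $f_1$ is replaced (Whitehead move in a disc neighbourhood of $f_1$) by an edge $f_1'$ crossing $c_1'$ once, oriented from a vertex with counterclockwise order $(f_1',f_5,f_2)$ to a vertex with counterclockwise order $(f_1',f_3,f_4)$. The loops $(\gamma_1,\gamma_2,\gamma_3,\gamma_4,\gamma_5)$ for $f_1$ are replaced by $(\gamma_3\gamma_4,\gamma_5,\gamma_2,\gamma_3,\gamma_4)$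 for $f_1'$. $e_1'$ is a chosen eigenvalue of $\rho(\gamma_3\gamma_4)$, the other eigenvalue parameters are kept, $t_1'$ is the twist parameter of $f_1'$ and $t_i'$ that of $f_i$ ($i=2,\dots,5$) for the new graph. *)

(* Defs.v *)
From mathcomp Require Import all_boot all_order all_algebra.
From mathcomp Require Import reals complex.
Set Implicit Arguments.
Unset Strict Implicit.
Unset Printing Implicit Defensive.
Import Order.TTheory GRing.Theory Num.Theory.
Local Open Scope ring_scope.

(* A surface with a pants decomposition and a dual graph is encoded by the
   half-edges at the trivalent vertices.  An orbit {h, nxt h, nxt (nxt h)} is a
   trivalent vertex, i.e. a pair of pants, nxt being the counterclockwise order.
   An orbit {h, mate h} is an edge, i.e. a pants curve: mate h is the other half of
   an interior edge, and mate h = h for a boundary edge, whose half at the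
   univalent vertex is not represented.  out h holds when the edge is oriented
   away from the trivalent vertex of h. *)
Record dual_graph (H : finType) := DualGraph {
  nxt : H -> H;
  mate : H -> H;
  out : H -> bool }.

Definition dual_graph_axioms (H : finType) (G : dual_graph H) : Prop :=
  [/\ forall h, nxt G (nxt G (nxt G h)) = h,
      forall h, nxt G h != h,
      involutive (mate G)
    & forall h, mate G h != h -> out G (mate G h) = ~~ out G h].

Section Surface.
Variable H : finType.
Implicit Types (G S : dual_graph H) (h k : H) (b : bool).

Definition interior G h : bool := mate G h != h.

Definition vertex G h : {set H} := [set h; nxt G h; nxt G (nxt G h)].
Definition edge G h : {set H} := [set h; mate G h].

(* The surface S of a dual graph as a CW complex.  0-cells: the trivalent
   vertices, and one point on each pants curve, where the edge meets it.
   1-cells: Along h, from the vertex of h to the point of its pants curve, and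
   Around h, the boundary component at h of the pair of pants of h, run once with
   the hole on the left; mate h runs the same curve backwards.
   2-cells: each pair of pants cut along its tripod is a disc, with boundary
   word pants_word.  The flag true means that a 1-cell is run backwards. *)
Definition point : Type := ({set H} + {set H})%type.
Definition pt_vertex S h : point := inl (vertex S h).
Definition pt_edge S h : point := inr (edge S h).
Definition is_point S (x : point) : Prop :=
  exists h, x = pt_vertex S h \/ x = pt_edge S h.

Inductive step := Along of H & bool | Around of H & bool.

Definition source S (s : step) : point :=
  match s with
  | Along h b => if b then pt_edge S h else pt_vertex S h
  | Around h _ => pt_edge S h
  end.

Definition inv_step (s : step) : step :=
  match s with
  | Along h b => Along h (~~ b)
  | Around h b => Around h (~~ b)
  end.

Definition target S (s : step) : point := source S (inv_step s).

Fixpoint is_path S (x : point) (w : seq step) (y : point) : bool :=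
  if w is s :: w' then (source S s == x) && is_path S (target S s) w' y
  else x == y.

Definition is_loop S (x : point) (w : seq step) : bool := is_path S x w x.

Definition inv_path (w : seq step) : seq step := map inv_step (rev w).

Definition connected S : Prop :=
  forall x y, is_point S x -> is_point S y -> exists w, is_path S x w y.

(* The loop, based on the edge of f, which goes along f to its vertex, along the
   half-edge h (at the same vertex) to the boundary, once around it with the
   hole on the left, and back. *)
Definition lasso f h : seq step :=
  [:: Along f true; Along h false; Around h false; Along h true; Along f false].

Definition spoke h : seq step :=
  [:: Along h false; Around h false; Along h true].

Definition pants_word S h : seq step :=
  spoke h ++ spoke (nxt S h) ++ spoke (nxt S (nxt S h)).

(* Elementary homotopies of edge paths: two loops of S are homotopic iff they
   are joined by a chain of these, used in either direction. *)
Inductive elementary S : seq step -> seq step -> Prop :=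
| Elem_cancel u s v : elementary S (u ++ s :: inv_step s :: v) (u ++ v)
| Elem_pants u h v : elementary S (u ++ pants_word S h ++ v) (u ++ v)
| Elem_glue u h b v : interior S h ->
    elementary S (u ++ Around (mate S h) b :: v) (u ++ Around h (~~ b) :: v).

(* A pants decomposition with dual graph on S (not necessarily the one defining
   the cells of S): its combinatorics, and an edge path of S homotopic to each
   of its 1-cells.  The point of every edge is placed at the point pt_edge S h of
   the half-edge with the same name. *)
Record pants_decomposition := PantsDecomposition {
  graph :> dual_graph H;
  realize1 : step -> seq step }.

Definition realize (D : pants_decomposition) (w : seq step) : seq step :=
  flatten (map (realize1 D) w).

Definition standard S : pants_decomposition :=
  PantsDecomposition S (fun s => [:: s]).

Section TypeV.
Variables (S : dual_graph H) (f1 : H).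
Let f2 := nxt S f1.
Let f3 := nxt S f2.
Let f1o := mate S f1.
Let f4 := nxt S f1o.
Let f5 := nxt S f4.

Definition typeV_nxt : H -> H :=
  [eta nxt S with f1 |-> f5, f5 |-> f2, f2 |-> f1,
                  f1o |-> f3, f3 |-> f4, f4 |-> f1o].

(* gamma_3 gamma_4 *)
Definition typeV_curve : seq step := lasso f1 f3 ++ lasso f1o f4.

(* The Whitehead move takes place in a disc around the edge f1.  The new edge is
   made to cross the new curve at the old base point pt_edge S f1, and both new
   vertices are collapsed to that point within the disc. *)
Definition typeV_realize1 (s : step) : seq step :=
  match s with
  | Along h b =>
      let w := if (h == f1) || (h == f1o) then [::]
               else if (h == f2) || (h == f3) then [:: Along f1 true; Along h false]
               else if (h == f4) || (h == f5) then [:: Along f1o true; Along h false]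
               else [:: Along h false] in
      if b then inv_path w else w
  | Around h b =>
      let w := if h == f1 then typeV_curve
               else if h == f1o then inv_path typeV_curve
               else [:: Around h false] in
      if b then inv_path w else w
  end.

Definition typeV : pants_decomposition :=
  PantsDecomposition (DualGraph typeV_nxt (mate S) (out S)) typeV_realize1.

End TypeV.

Section Representation.
Variables (C : numClosedFieldType) (S : dual_graph H) (x0 : point).
Variable rho : seq step -> 'M[C]_2.

(* rho is a homomorphism from pi_1(S, x0), the group of loops of 1-cells modulo
   elementary homotopies, to SL(2, C). *)
Definition is_representation : Prop :=
  [/\ forall u, is_loop S x0 u -> \det (rho u) = 1,
      forall u v, is_loop S x0 u -> is_loop S x0 v ->
        rho (u ++ v) = rho u *m rho v
    & forall u v, is_loop S x0 u -> is_loop S x0 v ->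
        elementary S u v -> rho u = rho v].

(* Nonzero column vectors stand for points of CP^1. *)
Definition fixes (M : 'M[C]_2) (x : 'cV[C]_2) : Prop :=
  x != 0 /\ exists c, M *m x = c *: x.
Definition same_pt (x y : 'cV[C]_2) : Prop := exists2 c, c != 0 & y = c *: x.

Definition exactly_two_fixed_points (M : 'M[C]_2) : Prop :=
  exists x y, [/\ fixes M x, fixes M y, ~ same_pt x y
                & forall z, fixes M z -> same_pt x z \/ same_pt y z].

Definition eigenvector (M : 'M[C]_2) (a : C) (x : 'cV[C]_2) : Prop :=
  x != 0 /\ M *m x = a *: x.

(* Loops of a decomposition D based on an edge are evaluated after transport to
   x0 along a path d; another d conjugates all values simultaneously. *)
Definition hol (D : pants_decomposition) (d w : seq step) : 'M[C]_2 :=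
  rho (d ++ realize D w ++ inv_path d).

Definition condition_C1 (D : pants_decomposition) : Prop :=
  forall h d, is_path S x0 d (pt_edge S h) ->
    exactly_two_fixed_points (hol D d [:: Around h false]).

(* Elements of pi_1 of the pair of pants of h, as words in the loops around its
   boundary components and their inverses. *)
Definition pants_loop h (w : seq (H * bool)) : seq step :=
  flatten [seq if p.2 then inv_path (lasso h p.1) else lasso h p.1 | p <- w].

Definition condition_C2 (D : pants_decomposition) : Prop :=
  forall h d, is_path S x0 d (pt_edge S h) ->
    ~ exists x : 'cV[C]_2, x != 0 /\
        forall w : seq (H * bool), all (fun p => p.1 \in vertex D h) w ->
          fixes (hol D d (pants_loop h w)) x.

Definition eigenvalue_parameters (D : pants_decomposition) (e : H -> C) : Prop :=
  (forall h, e (mate D h) = e h) /\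
  (forall h d, is_path S x0 d (pt_edge S h) ->
     eigenvalue (hol D d [:: Around h false]) (e h)).

Definition half_parameter (D : pants_decomposition) (e : H -> C) h : C :=
  if out D h then e h else (e h)^-1.

(* f is the initial half of an interior edge. *)
Definition twist_parameter (D : pants_decomposition) (e : H -> C) (f : H) (t : C)
    : Prop :=
  let f' := mate D f in
  let h2 := nxt D f in
  let h5 := nxt D (nxt D f') in
  t != 0 /\
  forall d, is_path S x0 d (pt_edge S f) ->
  exists x1 y1 x2 x5 : 'cV[C]_2, exists M : 'M[C]_2,
    [/\ eigenvector (hol D d (lasso f f)) (e f) x1,
        eigenvector (hol D d (lasso f f)) (e f)^-1 y1,
        eigenvector (hol D d (lasso f h2)) (half_parameter D e h2) x2
      & eigenvector (hol D d (lasso f' h5)) (half_parameter D e h5) x5]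
    /\ [/\ M *m x1 = sqrtC (- t) *: x1,
           M *m y1 = (sqrtC (- t))^-1 *: y1
         & same_pt (M *m x2) x5].

(* The value of t is only relevant at initial halves of interior edges. *)
Definition twist_parameters (D : pants_decomposition) (e t : H -> C) : Prop :=
  forall f, interior D f -> out D f -> twist_parameter D e f (t f).

End Representation.

End Surface.

Arguments Along {H}.
Arguments Around {H}.

(* Main.v *)
(* For vectors of C^2 let [x, y] be the determinant.  If A B G = 1 in SL(2), expanding an
   eigenvector of B in an eigenbasis (x, y) of A and pairing with an eigenvector of G shows
   that [y, xb] [x, xg] (g - a b) = [x, xb] [y, xg] (g - b / a): the cross-ratio of the four
   fixed points depends on the eigenvalues only.  A twist parameter is minus a cross-ratio,
   t = - [y1, x5] [x1, x2] / ([y1, x2] [x1, x5]), so in the basis (x1, y1) the fixed points of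
   all old curves have explicit ratios in terms of e1, ..., e5 and t1.  For i = 2, ..., 5 the
   old and the new twist parameter of f_i compare the same point beyond f_i with two different
   points of the four-holed sphere, and t_i' / t_i is a cross-ratio of these; the fixed point of
   the new curve is eliminated by the identity above, applied to the new pairs of pants.
   The trace formulas hold for any configuration (G1, ..., G5) with G1 G2 G3 = 1 = G1^-1 G4 G5;
   applied to (G3 G4, G5, G2, G3, G4) they give the first formula for t_1'.  For the second one,
   [x3, (G3 G4 - E) x] is a functional vanishing at the fixed point of G3 G4 with eigenvalue E. *)
Require Import Defs.
From mathcomp Require Import all_boot all_order all_algebra.
From mathcomp Require Import reals complex ring.
Set Implicit Arguments.
Unset Strict Implicit.
Unset Printing Implicit Defensive.
Import Order.TTheory GRing.Theory Num.Theory.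
Local Open Scope ring_scope.

(** The formulas are identities between rational functions, so most of the work lies in seeing that
    nothing vanishes. Every denominator goes back to (C1), which makes each eigenvalue parameter
    different from its inverse, or to (C2), which makes fixed points of two different boundary loops
    of one pair of pants distinct. Both decompositions contribute: [t1 + 1 != 0], for instance, says
    that [x2] and [x5] are distinct, which holds because [G5] and [G2] bound a common new pair of
    pants. Points are nonzero vectors, and the relations expressing twists are homogeneous in each
    of them, so neither the scaling of an eigenvector nor the square root in the definition of a
    twist parameter matters. The twists of f2, ..., f5 are defined at different base points. Paths
    [k2], ..., [k5] carry them all to f1, which leaves pure algebra on one tuple of matrices,
    collected in [flip_config]. What lies beyond the far ends of f2, ..., f5 enters only as one
    unspecified vector that is eliminated. *)

Section Mx2.
Variable R : comNzRingType.

Lemma mulmx2E m n (A : 'M[R]_(m, 2)) (B : 'M[R]_(2, n)) i j :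
  (A *m B) i j = A i 0 * B 0 j + A i 1 * B 1 j.
Proof.
by rewrite mxE !big_ord_recl big_ord0 addr0 (_ : lift 0 0 = 1) //; apply: val_inj.
Qed.

Lemma mxtrace2 (M : 'M[R]_2) : \tr M = M 0 0 + M 1 1.
Proof.
rewrite /mxtrace !big_ord_recl big_ord0 addr0.
by rewrite (_ : lift 0 0 = 1) //; apply: val_inj.
Qed.

Lemma det_mx2 (M : 'M[R]_2) : \det M = M 0 0 * M 1 1 - M 0 1 * M 1 0.
Proof.
rewrite (expand_det_row _ ord0) !big_ord_recl big_ord0 addr0 /cofactor !det_mx11.
rewrite !mxE /= (_ : lift 0 0 = 1); last exact: val_inj.
rewrite (_ : lift 1 0 = 0); last exact: val_inj.
by rewrite expr0 mul1r expr1 mulN1r mulrN.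
Qed.

End Mx2.

(** * Brackets and triples of matrices with product 1 *)

Section Bracket.
Variable F : numClosedFieldType.
Implicit Types (A B G M : 'M[F]_2) (x y z p q : 'cV[F]_2) (a b c : F).

Definition br x y : F := x 0 0 * y 1 0 - x 1 0 * y 0 0.

Lemma ord2P (P : 'I_2 -> Prop) : P 0 -> P 1 -> forall i, P i.
Proof.
move=> P0 P1 [[|[|//]] lti].
  by rewrite (_ : Ordinal lti = 0) //; apply: val_inj.
by rewrite (_ : Ordinal lti = 1) //; apply: val_inj.
Qed.

Lemma cV2P x y : x 0 0 = y 0 0 -> x 1 0 = y 1 0 -> x = y.
Proof.
move=> e0 e1; apply/matrixP=> i j; rewrite (ord1 j).
by elim/ord2P: i.
Qed.

Lemma br_mul M x y : br (M *m x) (M *m y) = \det M * br x y.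
Proof. rewrite /br !mulmx2E det_mx2; ring. Qed.

Lemma br_tr M x y : br (M *m x) y + br x (M *m y) = \tr M * br x y.
Proof. rewrite /br !mulmx2E mxtrace2; ring. Qed.

Lemma brC x y : br x y = - br y x.
Proof. rewrite /br; ring. Qed.

Lemma brZl a x y : br (a *: x) y = a * br x y.
Proof. rewrite /br !mxE; ring. Qed.

Lemma brZr a x y : br x (a *: y) = a * br x y.
Proof. rewrite /br !mxE; ring. Qed.

Lemma brxx x : br x x = 0.
Proof. rewrite /br; ring. Qed.

Lemma plucker x y p q :
  br x y * br p q = br x p * br y q - br x q * br y p.
Proof. rewrite /br; ring. Qed.

Lemma br_span x y z : br x y *: z = br z y *: x + br x z *: y.
Proof. by apply: cV2P; rewrite !mxE /br; ring. Qed.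

Lemma br_same x y : x != 0 -> y != 0 -> br x y = 0 -> same_pt x y.
Proof.
move=> x0 y0 bxy.
(* Against such a [z], Cramer's rule [br_span] expresses [y] as a multiple of [x]. *)
have [z xz0] : exists z, br x z != 0.
  case: (eqVneq (x 0 0) 0) => [x00|x00].
    exists (delta_mx 0 0); rewrite /br !mxE /= x00 mul0r sub0r mulr1 oppr_eq0.
    by apply: contraNneq x0 => x10; apply/eqP/cV2P; rewrite mxE.
  by exists (delta_mx 1 0); rewrite /br !mxE /= mulr1 mulr0 subr0.
have Dy : y = (br y z / br x z) *: x.
  apply: (scalerI xz0); rewrite br_span bxy scale0r addr0 scalerA.
  by rewrite mulrCA divff // mulr1.
exists (br y z / br x z) => //; apply: contraNneq y0 => c0.
by rewrite Dy c0 scale0r.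
Qed.

Lemma eigenvector_br M a b x y :
  eigenvector M a x -> eigenvector M b y -> a != b -> br x y != 0.
Proof.
move=> [x0 Mx] [y0 My] ab; apply/negP=> /eqP /(br_same x0 y0) [c c0 Dy].
move: My; rewrite Dy -scalemxAr Mx !scalerA => /eqP.
rewrite -subr_eq0 -scalerBl scaler_eq0 (negbTE x0) orbF mulrC -mulrBl.
by rewrite mulf_eq0 subr_eq0 (negbTE ab) (negbTE c0).
Qed.

Lemma neq_inv_neq0 a : a != a^-1 -> a != 0.
Proof. by apply: contraNneq => ->; rewrite invr0. Qed.

Lemma neq_inv_sqr a : a != a^-1 -> a * a != 1.
Proof.
move=> aV; apply: contra aV => /eqP aa1; apply/eqP.
have a0 : a != 0 by apply/eqP=> a0; move: aa1; rewrite a0 mul0r => /eqP; rewrite eq_sym oner_eq0.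
by apply: (mulfI a0); rewrite aa1 divff.
Qed.

(** [M] preserves the bracket and also multiplies it by [a * a], which is not 1. *)
Lemma eigenvector_unique M a x y : \det M = 1 -> a != a^-1 ->
  eigenvector M a x -> eigenvector M a y -> same_pt x y.
Proof.
move=> dM aV [x0 Mx] [y0 My]; apply: br_same => //.
have /eqP := br_mul M x y; rewrite Mx My brZl brZr dM mul1r mulrA.
rewrite -subr_eq0 -[X in _ - X]mul1r -mulrBl mulf_eq0 subr_eq0.
by rewrite (negbTE (neq_inv_sqr aV)) => /eqP.
Qed.

(** Multiplying [(M - a) x = 0] by the adjugate of [M - a] gives the characteristic polynomial times
    each coordinate of [x], one of which is nonzero. Its constant term 1 excludes [a = 0]. *)
Lemma eigenvector_char M a x : \det M = 1 -> eigenvector M a x ->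
  a != 0 /\ \tr M = a + a^-1.
Proof.
move=> dM [x0 Mx].
have ch : a ^+ 2 - \tr M * a + 1 = 0.
  rewrite -dM det_mx2 mxtrace2.
  have E0 : (M 0 0 - a) * x 0 0 + M 0 1 * x 1 0 = 0.
    by rewrite mulrBl addrAC -mulmx2E Mx mxE subrr.
  have E1 : M 1 0 * x 0 0 + (M 1 1 - a) * x 1 0 = 0.
    by rewrite mulrBl addrA -mulmx2E Mx mxE subrr.
  case: (eqVneq (x 0 0) 0) => [x00|x00].
    have x10 : x 1 0 != 0.
      by apply: contraNneq x0 => x10; apply/eqP/cV2P; rewrite mxE.
    apply/(mulfI x10).
    transitivity ((M 0 0 - a) * (M 1 0 * x 0 0 + (M 1 1 - a) * x 1 0)
                  - M 1 0 * ((M 0 0 - a) * x 0 0 + M 0 1 * x 1 0)); first by ring.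
    by rewrite E0 E1 !mulr0 subrr.
  apply/(mulfI x00).
  transitivity ((M 1 1 - a) * ((M 0 0 - a) * x 0 0 + M 0 1 * x 1 0)
                - M 0 1 * (M 1 0 * x 0 0 + (M 1 1 - a) * x 1 0)); first by ring.
  by rewrite E0 E1 !mulr0 subrr.
have a0 : a != 0.
  by apply/eqP=> a0; move/eqP: ch; rewrite a0 expr0n mulr0 subr0 add0r oner_eq0.
split=> //; apply: (mulIf a0); rewrite mulrDl mulVf //.
by apply/eqP; rewrite -subr_eq0 -oppr_eq0 -ch; apply/eqP; ring.
Qed.

Lemma eigenvalue_char M a : \det M = 1 -> eigenvalue M a -> a ^+ 2 - \tr M * a + 1 = 0.
Proof.
move=> dM; rewrite eigenvalue_root_char /root /char_poly => /eqP.
rewrite det_mx2 !mxE /= !(hornerE, mulr1n, mulr0n) => <-.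
rewrite -[X in _ + X]dM det_mx2 mxtrace2.
ring.
Qed.

(** If [a = a^-1], then [a] is a double root of the characteristic polynomial, so both fixed points
    have the eigenvalue [a], and their sum would be a third fixed point. *)
Lemma regular_eigenvalue M a : \det M = 1 -> exactly_two_fixed_points M ->
  eigenvalue M a -> a != a^-1.
Proof.
move=> dM [x [y [[x0 [c Mx]] [y0 [c' My]] nxy two]]] /(eigenvalue_char dM) ch.
have xy0 : br x y != 0 by apply/eqP=> /(br_same x0 y0).
have cc : c * c' = 1.
  by apply: (mulIf xy0); rewrite -mulrA -brZr -brZl -Mx -My br_mul dM.
have tM : \tr M = c + c'.
  by apply: (mulIf xy0); rewrite -br_tr Mx My brZl brZr mulrDl.
apply/eqP=> aV.
have a0 : a != 0.
  by apply/eqP=> a0; move/eqP: ch; rewrite a0 expr0n mulr0 subr0 add0r oner_eq0.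
have aa : a * a = 1 by rewrite {2}aV divff.
have ca : c = a /\ c' = a.
  have s2 : c + c' = a *+ 2.
    apply: (mulIf a0); apply/eqP; rewrite -tM -subr_eq0 -oppr_eq0 -ch -aa.
    by apply/eqP; ring.
  have : (c - a) ^+ 2 = 0.
    transitivity (c * (c - a *+ 2) + a * a); first by ring.
    by rewrite -s2 aa -cc; ring.
  move/eqP; rewrite sqrf_eq0 subr_eq0 => /eqP ca; split=> //.
  by apply: (addrI c); rewrite s2 ca mulr2n.
case: ca => ca c'a; rewrite ca in Mx; rewrite c'a in My.
have fxy : fixes M (x + y).
  split; last by exists a; rewrite mulmxDr Mx My scalerDr.
  by apply: contraNneq xy0 => xyE; rewrite -(addKr x y) xyE addr0 /br !mxE; apply/eqP; ring.
case: (two _ fxy) => -[k k0 /(congr1 (fun z => (br x z, br y z)))] [].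
  by move=> + _; rewrite brZr brxx mulr0 => E; case/negP: xy0; rewrite -E /br !mxE; apply/eqP; ring.
move=> _; rewrite brZr brxx mulr0 => E; case/negP: xy0; rewrite -oppr_eq0 -E /br !mxE.
by apply/eqP; ring.
Qed.

(** [M] has determinant 1, hence divides the bracket with [X] by [s] and multiplies the one with [Y]
    by [s]. Only [s ^+ 2] survives in the cross-ratio. *)
Lemma twist_br_mx M s X Y p q : s != 0 -> br X Y != 0 ->
  M *m X = s *: X -> M *m Y = s^-1 *: Y -> same_pt (M *m p) q ->
  br Y q * br X p = s ^+ 2 * br Y p * br X q.
Proof.
move=> s0 XY MX MY [k k0 ->].
have dM : \det M = 1.
  apply: (mulIf XY); rewrite -br_mul MX MY brZl brZr; field; exact: s0.
have EX : s * br X (M *m p) = br X p by rewrite -brZl -MX br_mul dM mul1r.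
have EY : s^-1 * br Y (M *m p) = br Y p by rewrite -brZl -MY br_mul dM mul1r.
rewrite !brZr -EX -EY; field; exact: s0.
Qed.

Section Pants.
Variables (A B G : 'M[F]_2).
Hypothesis dG : \det G = 1.
Hypothesis ABG : A *m B *m G = 1%:M.

Lemma pants_rot : B *m G *m A = 1%:M.
Proof. by apply: mulmx1C; rewrite mulmxA. Qed.

Lemma pants_br a a' b c xa ya xb xc :
  eigenvector A a xa -> eigenvector A a' ya ->
  eigenvector B b xb -> eigenvector G c xc ->
  br ya xb * br xa xc * (c - a * b) = br xa xb * br ya xc * (c - b * a').
Proof.
move=> [_ Aa] [_ Aa'] [_ Bb] [_ Gc].
(* As [G A B = 1] and [G] preserves the bracket, pairing [G xc] with [xb] amounts to pairing [xc]
   with [A B xb]. *)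
have E : c * br xc xb = b * br xc (A *m xb).
  rewrite -brZl -Gc -[X in br _ X]mul1mx -(mulmx1C ABG) -!mulmxA br_mul dG mul1r.
  by rewrite Bb -scalemxAr brZr.
have D : br xa ya *: (A *m xb) = (br xb ya * a) *: xa + (br xa xb * a') *: ya.
  by rewrite scalemxAr br_span mulmxDr -!scalemxAr Aa Aa' !scalerA.
have {}D : br xa ya * br xc (A *m xb) =
    br xb ya * a * br xc xa + br xa xb * a' * br xc ya.
  by rewrite -brZr D /br !mxE; ring.
have : c * (br xa ya * br xc xb) = b * (br xa ya * br xc (A *m xb)).
  by rewrite mulrCA E mulrCA.
rewrite D plucker (brC xb ya) (brC xc xa) (brC xc ya) => /eqP.
rewrite -subr_eq0 => /eqP H; apply/eqP; rewrite -subr_eq0 -H; apply/eqP; ring.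
Qed.

Definition no_common_fixed_point := forall x, fixes A x -> fixes B x -> fixes G x -> False.

Hypothesis irr : no_common_fixed_point.

(** A common eigenvector of [A] and [B] is also one of [G], the inverse of [A B]. *)
Lemma pants_br_neq0 a b xa xb :
  eigenvector A a xa -> eigenvector B b xb -> br xa xb != 0.
Proof.
move=> [xa0 Aa] [xb0 Bb]; apply/eqP=> /(br_same xa0 xb0) [k k0 Dxb].
have Ba : B *m xa = b *: xa.
  by apply: (scalerI k0); rewrite scalemxAr -Dxb Bb Dxb !scalerA mulrC.
have GE : (a * b) *: (G *m xa) = xa.
  rewrite scalemxAr.
  have <- : A *m (B *m xa) = (a * b) *: xa.
    by rewrite Ba -scalemxAr Aa scalerA mulrC.
  by rewrite !mulmxA -(mulmxA G) (mulmx1C ABG) mul1mx.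
have ab0 : a * b != 0.
  by apply: contraNneq xa0 => ab0; rewrite -GE ab0 scale0r.
apply: (irr (x := xa)); split=> //; [by exists a | by exists b | exists (a * b)^-1].
by apply: (scalerI ab0); rewrite GE scalerA divff // scale1r.
Qed.
End Pants.

(** The affine coordinate of the point [p] of the projective line with zero at [y] and pole at [x].
    It does not depend on the scale of [p]; rescaling [x] or [y] multiplies it by a constant, so
    only quotients of values for the same [x] and [y] have a geometric meaning. *)
Definition ratio x y p := br y p / br x p.

Section PantsRatio.
Variables (A B G : 'M[F]_2).
Hypothesis dB : \det B = 1.
Hypothesis dG : \det G = 1.
Hypothesis ABG : A *m B *m G = 1%:M.
Hypothesis irr : no_common_fixed_point A B G.

Lemma irreducible_rot : no_common_fixed_point B G A.
Proof. by move=> x Bx Gx Ax; apply: (irr (x := x)). Qed.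

(** This is [pants_br] solved for a coordinate. Since all four brackets in it are nonzero, its two
    eigenvalue factors can only vanish together, and then [a * b = b * a^-1], contrary to
    [a != a^-1]. *)
Lemma pants_ratio a b c xa ya xb xc : a != a^-1 ->
  eigenvector A a xa -> eigenvector A a^-1 ya ->
  eigenvector B b xb -> eigenvector G c xc ->
  [/\ c - a * b != 0, c - b * a^-1 != 0
    & ratio xa ya xc = ratio xa ya xb * ((c - a * b) / (c - b * a^-1))].
Proof.
move=> aV Aa Aa' Bb Gc.
have irr3 := irreducible_rot.
have irr2 : no_common_fixed_point G A B by move=> x Gx Ax Bx; apply: (irr (x := x)).
have BGA := pants_rot ABG; have GAB := pants_rot BGA.
have ab := pants_br_neq0 ABG irr Aa Bb.
have a'b := pants_br_neq0 ABG irr Aa' Bb.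
have ac : br xa xc != 0.
  by rewrite brC oppr_eq0; apply: (pants_br_neq0 GAB irr2 Gc Aa).
have a'c : br ya xc != 0.
  by rewrite brC oppr_eq0; apply: (pants_br_neq0 GAB irr2 Gc Aa').
have [b0 _] := eigenvector_char dB Bb.
have E := pants_br dG ABG Aa Aa' Bb Gc.
have nE : (c - a * b == 0) = (c - b * a^-1 == 0).
  have : (br ya xb * br xa xc * (c - a * b) == 0) =
         (br xa xb * br ya xc * (c - b * a^-1) == 0) by rewrite E.
  by rewrite !mulf_eq0 (negbTE ab) (negbTE a'b) (negbTE ac) (negbTE a'c).
have n1 : c - b * a^-1 != 0.
  apply/eqP=> c1; move: nE; rewrite c1 eqxx => /eqP c2.
  case/eqP: aV; apply: (mulfI b0).
  by rewrite -(subr0_eq c1) (subr0_eq c2) mulrC.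
split; rewrite ?nE //.
rewrite /ratio; apply: (mulIf ac); rewrite divfK //.
apply: (mulfI ab); apply: (mulIf n1); rewrite -E; field.
have a0 := neq_inv_neq0 aV; rewrite a0 ab andbT /=.
by apply: contraNneq n1 => cab; rewrite -(mulfI a0 (x1 := c - b / a) (x2 := 0)) // mulr0 -cab; field.
Qed.

Lemma pants_br_neq0_ac a c xa xc :
  eigenvector A a xa -> eigenvector G c xc -> br xa xc != 0.
Proof.
move=> Aa Gc; rewrite brC oppr_eq0; apply: pants_br_neq0 Gc Aa.
  exact: pants_rot (pants_rot ABG).
by move=> x Gx Ax Bx; apply: (irr (x := x)).
Qed.
End PantsRatio.

Lemma br_mul_inv M N x y : M *m N = 1%:M -> \det M = 1 -> br (M *m x) y = br x (N *m y).
Proof.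
by move=> MN dM; rewrite -{1}[y]mul1mx -MN -mulmxA br_mul dM mul1r.
Qed.

(** The brackets on the right are the entries of [A] and [B] in the basis [(x, y)], each multiplied
    by [br x y]. *)
Lemma trace_mul_br A B x y : br x y ^+ 2 * \tr (A *m B) =
  br (A *m x) y * br (B *m x) y + br x (A *m y) * br x (B *m y)
  + br (A *m y) y * br x (B *m x) + br x (A *m x) * br (B *m y) y.
Proof. rewrite mxtrace2 /br !mulmx2E; ring. Qed.

(** * Trace formulas *)

Section Quad.
Variables (G1 G2 G3 G4 G5 : 'M[F]_2) (e1 e2 e3 e4 e5 t : F) (x1 y1 x2 x5 : 'cV[F]_2).
Hypothesis d1 : \det G1 = 1.
Hypothesis d2 : \det G2 = 1.
Hypothesis d3 : \det G3 = 1.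
Hypothesis d4 : \det G4 = 1.
Hypothesis d5 : \det G5 = 1.
Hypothesis G123 : G1 *m G2 *m G3 = 1%:M.
Hypothesis G45 : G4 *m G5 = G1.
Hypothesis tr2 : \tr G2 = e2 + e2^-1.
Hypothesis tr3 : \tr G3 = e3 + e3^-1.
Hypothesis tr4 : \tr G4 = e4 + e4^-1.
Hypothesis tr5 : \tr G5 = e5 + e5^-1.
Hypothesis e1V : e1 != e1^-1.
Hypothesis e2_neq0 : e2 != 0.
Hypothesis e3_neq0 : e3 != 0.
Hypothesis e4_neq0 : e4 != 0.
Hypothesis e5_neq0 : e5 != 0.
Hypothesis ex1 : eigenvector G1 e1 x1.
Hypothesis ey1 : eigenvector G1 e1^-1 y1.
Hypothesis ex2 : eigenvector G2 e2 x2.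
Hypothesis ex5 : eigenvector G5 e5 x5.
Hypothesis x12 : br x1 x2 != 0.
Hypothesis y12 : br y1 x2 != 0.
Hypothesis x15 : br x1 x5 != 0.
Hypothesis y15 : br y1 x5 != 0.
Hypothesis tw : br y1 x5 * br x1 x2 = - t * br y1 x2 * br x1 x5.

Let D := br x1 y1.

Lemma quad_D : D != 0.
Proof. exact: eigenvector_br ex1 ey1 e1V. Qed.

(** In the basis [(x1, y1)], the matrix [M] has first row [pp M], [qq M] and second row [rr M],
    [ss M]. There [G1] and its inverse [N] are diagonal. *)
Let pp M := br (M *m x1) y1 / D.
Let ss M := br x1 (M *m y1) / D.
Let qq M := br (M *m y1) y1 / D.
Let rr M := br x1 (M *m x1) / D.
Let N := G2 *m G3.

Lemma quad_tr M : \tr M = pp M + ss M.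
Proof.
by have D0 := quad_D; apply: (mulIf D0); rewrite -br_tr mulrDl !divfK.
Qed.

Lemma quad_trM A B : \tr (A *m B) = pp A * pp B + ss A * ss B + qq A * rr B + rr A * qq B.
Proof.
have D20 : D ^+ 2 != 0 by rewrite expf_neq0 ?quad_D.
apply: (mulfI D20); rewrite trace_mul_br /pp /ss /qq /rr; field; exact: quad_D.
Qed.

Lemma quad_tr_diag A a b M : A *m x1 = a *: x1 -> A *m y1 = b *: y1 ->
  \tr (A *m M) = a * pp M + b * ss M.
Proof.
move=> Ax Ay; rewrite quad_trM.
have -> : pp A = a by rewrite /pp Ax brZl mulfK // quad_D.
have -> : ss A = b by rewrite /ss Ay brZr mulfK // quad_D.
have -> : qq A = 0 by rewrite /qq Ay brZl brxx mulr0 mul0r.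
have -> : rr A = 0 by rewrite /rr Ax brZr brxx mulr0 mul0r.
by rewrite !mul0r !addr0.
Qed.

Lemma tr_inv (A B : 'M[F]_2) : \det A = 1 -> A *m B = 1%:M -> \tr A = \tr B.
Proof.
move=> dA AB; have D0 := quad_D; apply: (mulIf D0).
rewrite -!br_tr (br_mul_inv _ _ AB) // addrC; congr (_ + _).
by rewrite brC (br_mul_inv _ _ AB) // brC opprK.
Qed.

Lemma quad_NG1 : N *m G1 = 1%:M.
Proof. by apply: mulmx1C; rewrite mulmxA. Qed.

Lemma quad_Nx1 : N *m x1 = e1^-1 *: x1.
Proof.
have e10 := neq_inv_neq0 e1V; apply: (scalerI e10).
rewrite scalemxAr; have [_ <-] := ex1.
by rewrite mulmxA quad_NG1 mul1mx scalerA divff // scale1r.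
Qed.

Lemma quad_Ny1 : N *m y1 = e1 *: y1.
Proof.
have e10 : e1^-1 != 0 by rewrite invr_eq0 (neq_inv_neq0 e1V).
apply: (scalerI e10).
rewrite scalemxAr; have [_ <-] := ey1.
by rewrite mulmxA quad_NG1 mul1mx scalerA mulVf ?scale1r // (neq_inv_neq0 e1V).
Qed.

Lemma quad_N45 : N *m G4 *m G5 = 1%:M.
Proof. by rewrite -mulmxA G45 quad_NG1. Qed.

(** The two rows of [(M - e) x = 0], as [x] has coordinates [br x y1 / D] and [br x1 x / D]. They
    yield the off-diagonal entries from the diagonal ones and the position of a fixed point. *)
Lemma quad_eig M e x : M *m x = e *: x ->
  qq M * br x1 x = (e - pp M) * br x y1 /\ rr M * br x y1 = (e - ss M) * br x1 x.
Proof.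
have D0 := quad_D; move=> Mx.
have E : e *: (D *: x) = br x y1 *: (M *m x1) + br x1 x *: (M *m y1).
  by rewrite scalerA mulrC -scalerA -Mx scalemxAr /D (br_span x1 y1 x) mulmxDr -!scalemxAr.
have /= Ey := congr1 (br ^~ y1) E; have /= Ex := congr1 (br x1) E.
have {}Ey : e * (D * br x y1) = br x y1 * br (M *m x1) y1 + br x1 x * br (M *m y1) y1.
  by rewrite -!brZl Ey /br !mxE; ring.
have {}Ex : e * (D * br x1 x) = br x y1 * br x1 (M *m x1) + br x1 x * br x1 (M *m y1).
  by rewrite -!brZr Ex /br !mxE; ring.
rewrite /qq /rr /pp /ss; split; apply: (mulfI D0); apply/eqP; rewrite -subr_eq0.
  transitivity (br x y1 * br (M *m x1) y1 + br x1 x * br (M *m y1) y1 - e * (D * br x y1) == 0).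
    by congr (_ == 0); field; exact: D0.
  by rewrite Ey subrr eqxx.
transitivity (br x y1 * br x1 (M *m x1) + br x1 x * br x1 (M *m y1) - e * (D * br x1 x) == 0).
  by congr (_ == 0); field; exact: D0.
by rewrite Ex subrr eqxx.
Qed.

(** Inversion in SL(2) negates the off-diagonal entries, and [G3] is the inverse of [G1 G2], where
    the diagonal [G1] scales the rows of [G2]. The same reason gives [quad_q3] and, with [G4] the
    inverse of [G5 N] and scaled columns, [quad_r4] and [quad_q4]. *)
Lemma quad_r3 : rr G3 = - rr G2 / e1.
Proof.
have e10 := neq_inv_neq0 e1V; have G3I := mulmx1C G123.
have E : br x1 (G2 *m x1) = e1 * br x1 (G1 *m G2 *m x1).
  by rewrite -[LHS]mul1r -d1 -br_mul; have [_ ->] := ex1; rewrite brZl mulmxA.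
rewrite /rr brC (br_mul_inv _ _ G3I) // E; field.
by rewrite e10 quad_D.
Qed.

Lemma quad_q3 : qq G3 = - e1 * qq G2.
Proof.
have e10 := neq_inv_neq0 e1V; have G3I := mulmx1C G123.
have E : br y1 (G2 *m y1) = e1^-1 * br y1 (G1 *m G2 *m y1).
  by rewrite -[LHS]mul1r -d1 -br_mul; have [_ ->] := ey1; rewrite brZl mulmxA.
rewrite /qq (br_mul_inv _ _ G3I) // (brC (G2 *m _)) E; field.
by rewrite e10 quad_D.
Qed.

Lemma quad_4I : G4 *m (G5 *m N) = 1%:M.
Proof. by apply: mulmx1C; rewrite -mulmxA; apply: mulmx1C; rewrite quad_N45. Qed.

Lemma quad_r4 : rr G4 = - rr G5 / e1.
Proof.
rewrite /rr brC (br_mul_inv _ _ quad_4I) // -mulmxA quad_Nx1 -scalemxAr brZr; field.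
by rewrite (neq_inv_neq0 e1V) quad_D.
Qed.

Lemma quad_q4 : qq G4 = - e1 * qq G5.
Proof.
rewrite /qq (br_mul_inv _ _ quad_4I) // -mulmxA quad_Ny1 -scalemxAr brZr brC; field.
exact: quad_D.
Qed.

Let s1 := e1 + e1^-1.
Let s2 := e2 + e2^-1.
Let s3 := e3 + e3^-1.
Let s4 := e4 + e4^-1.
Let s5 := e5 + e5^-1.
(** [K] is [(e1 - e1^-1) ^+ 2 * (e2 - ss G2) * (e5 - pp G5)] in factored form; [L] is the same with
    [pp] and [ss] exchanged. *)
Let K : F := (e2 * e3 - e1) * (e1 * e3 - e2) / (e1 * e2 * e3)
           * ((e4 * e5 - e1) * (e1 * e4 - e5) / (e1 * e4 * e5)).
Let L : F := (1 - e1 * e2 * e3) * (e1 * e2 - e3) / (e1 * e2 * e3)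
           * ((1 - e1 * e4 * e5) * (e1 * e5 - e4) / (e1 * e4 * e5)).

(** The diagonal entries of each matrix follow from its trace and the trace of its product with [G1]
    or [N]. The off-diagonal entries depend on the scaling of [x1] and [y1], but the traces only
    involve the products [qq G2 * rr G5] and [rr G2 * qq G5], which the twist determines. *)
Lemma quad_traces :
  [/\ (e1 - e1^-1) ^+ 2 * \tr (G3 *m G4) =
        - K * t - L * t^-1
        + s1 * (s3 * s5 + s2 * s4) - 2 * (s2 * s5 + s3 * s4),
      (e1 - e1^-1) ^+ 2 * \tr (G2 *m G4) =
        K * (e1 * t) + L * (e1 * t)^-1
        + s1 * (s2 * s5 + s3 * s4) - 2 * (s2 * s4 + s3 * s5)
    & (e1 - e1^-1) ^+ 2 * \tr (G3 *m G5) =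
        K * e1^-1 * t + L * e1 * t^-1
        + s1 * (s2 * s5 + s3 * s4) - 2 * (s2 * s4 + s3 * s5)].
Proof.
have e10 := neq_inv_neq0 e1V.
have w0 : e1 * e1 - 1 != 0 by rewrite subr_eq0 neq_inv_sqr.
have t0 : t != 0.
  by apply: contraNneq (mulf_neq0 y15 x12) => t0; rewrite tw t0 oppr0 !mul0r.
have solve (p s a b : F) : p + s = a -> e1 * p + e1^-1 * s = b ->
    p = (e1 * b - a) / (e1 * e1 - 1) /\ s = (e1 * e1 * a - e1 * b) / (e1 * e1 - 1).
  by move=> <- <-; split; field; rewrite e10 w0.
have D1 : G1 *m x1 = e1 *: x1 by case: ex1.
have D1' : G1 *m y1 = e1^-1 *: y1 by case: ey1.
have G231 : G2 *m G3 *m G1 = 1%:M := pants_rot G123.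
have G312 : G3 *m (G1 *m G2) = 1%:M := mulmx1C G123.
have G5N4 : G5 *m (N *m G4) = 1%:M := mulmx1C quad_N45.
have [p2 q2] := solve (pp G2) (ss G2) s2 s3 (esym (etrans (esym tr2) (quad_tr G2)))
  (etrans (esym (quad_tr_diag G2 D1 D1')) (etrans (esym (tr_inv d3 G312)) tr3)).
have G3G1 : \tr (G1 *m G3) = s2.
  rewrite mxtrace_mulC; apply: etrans tr2; apply/esym/tr_inv => //; by rewrite mulmxA.
have [p3 q3] := solve (pp G3) (ss G3) s3 s2 (esym (etrans (esym tr3) (quad_tr G3)))
  (etrans (esym (quad_tr_diag G3 D1 D1')) G3G1).
have NG4 : \tr (N *m G4) = s5 by rewrite -(tr_inv d5 G5N4) tr5.
have NG5 : \tr (N *m G5) = s4 by rewrite mxtrace_mulC -(tr_inv d4 quad_4I) tr4.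
have [q4 p4] := solve (ss G4) (pp G4) s4 s5
  (etrans (addrC _ _) (esym (etrans (esym tr4) (quad_tr G4))))
  (etrans (addrC _ _) (etrans (esym (quad_tr_diag G4 quad_Nx1 quad_Ny1)) NG4)).
have [q5 p5] := solve (ss G5) (pp G5) s5 s4
  (etrans (addrC _ _) (esym (etrans (esym tr5) (quad_tr G5))))
  (etrans (addrC _ _) (etrans (esym (quad_tr_diag G5 quad_Nx1 quad_Ny1)) NG5)).
have [Q2 R2] := quad_eig ex2.2; have [Q5 R5] := quad_eig ex5.2.
(* [quad_eig] for [x2] and [x5] leaves a quotient of brackets which is the cross-ratio in [tw]. *)
have qr : qq G2 * rr G5 = - ((e2 - pp G2) * (e5 - ss G5)) / t.
  apply: (mulIf t0); apply: (mulIf (mulf_neq0 x12 y15)).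
  transitivity (- t * (qq G2 * br x1 x2) * (rr G5 * br x5 y1)).
    by rewrite (brC x5); ring.
  rewrite Q2 R5 (brC x2).
  transitivity ((e2 - pp G2) * (e5 - ss G5) * - (- t * br y1 x2 * br x1 x5)).
    by ring.
  by rewrite -tw; field.
have rq : rr G2 * qq G5 = - ((e2 - ss G2) * (e5 - pp G5)) * t.
  apply: (mulIf (mulf_neq0 y12 x15)).
  transitivity (- (rr G2 * br x2 y1) * (qq G5 * br x1 x5)).
    by rewrite (brC x2); ring.
  rewrite R2 Q5 (brC x5).
  transitivity ((e2 - ss G2) * (e5 - pp G5) * (br y1 x5 * br x1 x2)); first by ring.
  by rewrite tw; ring.
rewrite !quad_trM quad_q3 quad_r3 quad_q4 quad_r4.
have -> : - e1 * qq G2 * (- rr G5 / e1) = qq G2 * rr G5 by field.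
have -> : - rr G2 / e1 * (- e1 * qq G5) = rr G2 * qq G5 by field.
have -> : qq G2 * (- rr G5 / e1) = - (qq G2 * rr G5) / e1 by field.
have -> : rr G2 * (- e1 * qq G5) = - e1 * (rr G2 * qq G5) by ring.
have -> : - e1 * qq G2 * rr G5 = - e1 * (qq G2 * rr G5) by ring.
have -> : - rr G2 / e1 * qq G5 = - (rr G2 * qq G5) / e1 by field.
rewrite qr rq p2 q2 p3 q3 p4 q4 p5 q5 /K /L /s1 /s2 /s3 /s4 /s5.
by split; field; rewrite e10 e2_neq0 e3_neq0 e4_neq0 e5_neq0 t0 w0.
Qed.

End Quad.

(** * Nonvanishing eigenvalue factors and changes of projective coordinate *)

Lemma inv_neq_inv a : a != a^-1 -> a^-1 != a^-1^-1.
Proof. by rewrite invrK eq_sym. Qed.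

(** Both fixed points of [B] are used: [pants_ratio] with eigenvalue [b] gives the factors
    [c - a * b] and [c - b * a^-1], and with [b^-1] the other two. *)
Lemma pants_neq A B G a b c xa ya xb yb xc :
  \det B = 1 -> \det G = 1 -> A *m B *m G = 1%:M ->
  no_common_fixed_point A B G -> a != a^-1 ->
  eigenvector A a xa -> eigenvector A a^-1 ya ->
  eigenvector B b xb -> eigenvector B b^-1 yb -> eigenvector G c xc ->
  [/\ a * b * c - 1 != 0, a * b - c != 0, a * c - b != 0 & b * c - a != 0].
Proof.
move=> dB dG ABG irr aV Aa Aa' Bb Bb' Gc.
have a0 := neq_inv_neq0 aV; have [b0 _] := eigenvector_char dB Bb.
have [n1 n2 _] := pants_ratio dB dG ABG irr aV Aa Aa' Bb Gc.
have [n3 n4 _] := pants_ratio dB dG ABG irr aV Aa Aa' Bb' Gc.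
split.
- have E : a * b * c - 1 = (c - b^-1 * a^-1) * (a * b) by field; apply/andP.
  by rewrite E mulf_neq0 // mulf_neq0.
- by rewrite -oppr_eq0 opprB.
- have E : a * c - b = (c - b * a^-1) * a by field.
  by rewrite E mulf_neq0.
have E : b * c - a = (c - a * b^-1) * b by field.
by rewrite E mulf_neq0.
Qed.

Lemma br_ratio x y p q : br x p != 0 -> br x q != 0 ->
  br x y * br p q = br x p * br x q * (ratio x y q - ratio x y p).
Proof.
by move=> xp xq; rewrite (plucker x y p q) /ratio; field; rewrite xp xq.
Qed.

Lemma ratio_sub_neq0 x y p q : br x y != 0 -> br x p != 0 -> br x q != 0 ->
  br p q != 0 -> ratio x y q - ratio x y p != 0.
Proof.
move=> xy xp xq pq; have := mulf_neq0 xy pq; rewrite br_ratio //.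
by rewrite mulf_eq0 negb_or => /andP[].
Qed.

Lemma ratio_base x X Y : ratio X Y x = br x Y / br x X.
Proof. by rewrite /ratio (brC Y) (brC X) invrN mulrNN. Qed.

(** A Moebius transformation is determined by its zero, its pole and one more value: in the
    coordinate [ratio x y] these are at [Y], at [X], and at infinity, which is the point [x]. *)
Lemma ratio_change x y X Y p : br x y != 0 ->
  br x X != 0 -> br x Y != 0 -> br x p != 0 -> br X p != 0 ->
  ratio X Y p =
  ratio X Y x * ((ratio x y p - ratio x y Y) / (ratio x y p - ratio x y X)).
Proof.
move=> xy xX xY xp Xp; have n := ratio_sub_neq0 xy xX xp Xp.
rewrite (ratio_base x X Y) {1}/ratio.
have -> : br Y p = br x Y * br x p * (ratio x y p - ratio x y Y) / br x y.
  by rewrite -br_ratio // mulrC mulKf.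
have -> : br X p = br x X * br x p * (ratio x y p - ratio x y X) / br x y.
  by rewrite -br_ratio // mulrC mulKf.
by field; rewrite xX xy xp n.
Qed.

Lemma eigenvector_inv M N a x : M *m N = 1%:M -> a != 0 ->
  eigenvector M a x -> eigenvector N a^-1 x.
Proof.
move=> /mulmx1C MN a0 [x0 Mx]; split=> //; apply: (scalerI a0).
by rewrite scalemxAr -Mx mulmxA MN mul1mx scalerA divff // scale1r.
Qed.

Lemma ratioV x y p : ratio y x p = (ratio x y p)^-1.
Proof. by rewrite /ratio invf_div. Qed.

End Bracket.

(** * The formulas for the twist parameters *)

Ltac nonzero_up_to_sign := match goal with
  | H : is_true (?p != 0) |- is_true (?q != 0) =>
      first [ exact: H
            | (have -> : q = p by ring); exact: H
            | (have -> : q = - p by ring); rewrite oppr_eq0; exact: H ]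
  end.
Ltac nonzero := rewrite /=; repeat (apply/andP; split);
  first [ assumption | rewrite -oppr_eq0 opprB; assumption | nonzero_up_to_sign ].

Section Flip.
Variable F : numClosedFieldType.
Implicit Types (G M P : 'M[F]_2) (a e E t : F) (x y z : 'cV[F]_2).

Definition eigenpair M a x y :=
  [/\ \det M = 1, a != a^-1, eigenvector M a x & eigenvector M a^-1 y].

(* G1o and Po are the inverses of G1 and P = G3 G4: the holonomies of the old and of the
   new curve seen from the other end of the edge. *)
Record flip_config G1 G1o G2 G3 G4 G5 P Po e1 e2 e3 e4 e5 E t1
    x1 y1 x2 y2 x3 y3 x4 y4 x5 y5 xP yP : Prop := FlipConfig {
  flip_pair1 : eigenpair G1 e1 x1 y1;
  flip_pair2 : eigenpair G2 e2 x2 y2;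
  flip_pair3 : eigenpair G3 e3 x3 y3;
  flip_pair4 : eigenpair G4 e4 x4 y4;
  flip_pair5 : eigenpair G5 e5 x5 y5;
  flip_pairP : eigenpair P E xP yP;
  flip_G11o : G1 *m G1o = 1%:M;
  flip_PPo : P *m Po = 1%:M;
  flip_G123 : G1 *m G2 *m G3 = 1%:M;
  flip_Go45 : G1o *m G4 *m G5 = 1%:M;
  flip_defP : P = G3 *m G4;
  flip_irr1 : no_common_fixed_point G1 G2 G3;
  flip_irr1o : no_common_fixed_point G1o G4 G5;
  flip_irrP : no_common_fixed_point P G5 G2;
  flip_irrPo : no_common_fixed_point Po G3 G4;
  flip_tw1 : ratio x1 y1 x5 = - t1 * ratio x1 y1 x2 }.

Variables (G1 G1o G2 G3 G4 G5 P Po : 'M[F]_2) (e1 e2 e3 e4 e5 E t1 : F).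
Variables (x1 y1 x2 y2 x3 y3 x4 y4 x5 y5 xP yP : 'cV[F]_2).
Hypothesis cfg : flip_config G1 G1o G2 G3 G4 G5 P Po e1 e2 e3 e4 e5 E t1
  x1 y1 x2 y2 x3 y3 x4 y4 x5 y5 xP yP.

Let d1 : \det G1 = 1. Proof. by case: (flip_pair1 cfg). Qed.
Let e1V : e1 != e1^-1. Proof. by case: (flip_pair1 cfg). Qed.
Let ex1 : eigenvector G1 e1 x1. Proof. by case: (flip_pair1 cfg). Qed.
Let ey1 : eigenvector G1 e1^-1 y1. Proof. by case: (flip_pair1 cfg). Qed.
Let d2 : \det G2 = 1. Proof. by case: (flip_pair2 cfg). Qed.
Let e2V : e2 != e2^-1. Proof. by case: (flip_pair2 cfg). Qed.
Let ex2 : eigenvector G2 e2 x2. Proof. by case: (flip_pair2 cfg). Qed.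
Let ey2 : eigenvector G2 e2^-1 y2. Proof. by case: (flip_pair2 cfg). Qed.
Let d3 : \det G3 = 1. Proof. by case: (flip_pair3 cfg). Qed.
Let e3V : e3 != e3^-1. Proof. by case: (flip_pair3 cfg). Qed.
Let ex3 : eigenvector G3 e3 x3. Proof. by case: (flip_pair3 cfg). Qed.
Let ey3 : eigenvector G3 e3^-1 y3. Proof. by case: (flip_pair3 cfg). Qed.
Let d4 : \det G4 = 1. Proof. by case: (flip_pair4 cfg). Qed.
Let e4V : e4 != e4^-1. Proof. by case: (flip_pair4 cfg). Qed.
Let ex4 : eigenvector G4 e4 x4. Proof. by case: (flip_pair4 cfg). Qed.
Let ey4 : eigenvector G4 e4^-1 y4. Proof. by case: (flip_pair4 cfg). Qed.
Let d5 : \det G5 = 1. Proof. by case: (flip_pair5 cfg). Qed.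
Let e5V : e5 != e5^-1. Proof. by case: (flip_pair5 cfg). Qed.
Let ex5 : eigenvector G5 e5 x5. Proof. by case: (flip_pair5 cfg). Qed.
Let ey5 : eigenvector G5 e5^-1 y5. Proof. by case: (flip_pair5 cfg). Qed.
Let dP : \det P = 1. Proof. by case: (flip_pairP cfg). Qed.
Let EV : E != E^-1. Proof. by case: (flip_pairP cfg). Qed.
Let exP : eigenvector P E xP. Proof. by case: (flip_pairP cfg). Qed.
Let eyP : eigenvector P E^-1 yP. Proof. by case: (flip_pairP cfg). Qed.
Let G11o := flip_G11o cfg.
Let PPo := flip_PPo cfg.
Let G123 := flip_G123 cfg.
Let Go45 := flip_Go45 cfg.
Let defP := flip_defP cfg.
Let irr1 := flip_irr1 cfg.
Let irr1o := flip_irr1o cfg.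
Let irrP := flip_irrP cfg.
Let irrPo := flip_irrPo cfg.
Let tw1 := flip_tw1 cfg.

Lemma det_right_inv M N : M *m N = 1%:M -> \det M = 1 -> \det N = 1.
Proof. by move=> MN dM; have := det1 F 2; rewrite -MN det_mulmx dM mul1r. Qed.

Let d1o : \det G1o = 1 := det_right_inv G11o d1.
Let dPo : \det Po = 1 := det_right_inv PPo dP.

Lemma flip_e_neq0 : [/\ e1 != 0, e2 != 0, e3 != 0, e4 != 0 & e5 != 0].
Proof. by split; apply: neq_inv_neq0. Qed.

Let flip_E0 : E != 0. Proof. exact: neq_inv_neq0. Qed.

Lemma flip_45 : G4 *m G5 = G1.
Proof. by rewrite -[LHS]mul1mx -G11o -!mulmxA (mulmxA G1o) Go45 mulmx1. Qed.

Lemma flip_P52 : P *m G5 *m G2 = 1%:M.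
Proof.
rewrite defP -(mulmxA G3) flip_45; apply: mulmx1C; rewrite mulmxA.
by apply: mulmx1C; rewrite mulmxA.
Qed.

Lemma flip_Po34 : Po *m G3 *m G4 = 1%:M.
Proof. by rewrite -mulmxA -defP (mulmx1C PPo). Qed.

(** Seen from the other end of the edge the loop is inverted, so [x1] and [y1] exchange roles, and
    so do [xP] and [yP]. *)
Let eo_y1 : eigenvector G1o e1 y1.
Proof. by rewrite -[e1]invrK; apply: eigenvector_inv G11o _ ey1; rewrite invr_eq0 neq_inv_neq0. Qed.

Let eo_x1 : eigenvector G1o e1^-1 x1.
Proof. by apply: eigenvector_inv G11o _ ex1; rewrite neq_inv_neq0. Qed.

Let eo_yP : eigenvector Po E yP.
Proof. by rewrite -[E]invrK; apply: eigenvector_inv PPo _ eyP; rewrite invr_eq0 neq_inv_neq0. Qed.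

Let eo_xP : eigenvector Po E^-1 xP.
Proof. by apply: eigenvector_inv PPo _ exP; rewrite neq_inv_neq0. Qed.

Lemma flip_n123 : [/\ e1 * e2 * e3 - 1 != 0, e1 * e2 - e3 != 0, e1 * e3 - e2 != 0
  & e2 * e3 - e1 != 0].
Proof. exact: pants_neq d2 d3 G123 irr1 e1V ex1 ey1 ex2 ey2 ex3. Qed.

Lemma flip_n145 : [/\ e1 * e4 * e5 - 1 != 0, e1 * e4 - e5 != 0, e1 * e5 - e4 != 0
  & e4 * e5 - e1 != 0].
Proof. exact: pants_neq d4 d5 Go45 irr1o e1V eo_y1 eo_x1 ex4 ey4 ex5. Qed.

Lemma flip_nP52 : [/\ E * e5 * e2 - 1 != 0, E * e5 - e2 != 0, E * e2 - e5 != 0 & e5 * e2 - E != 0].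
Proof. exact: pants_neq d5 d2 flip_P52 irrP EV exP eyP ex5 ey5 ex2. Qed.

Lemma flip_nPo34 : [/\ E * e3 * e4 - 1 != 0, E * e3 - e4 != 0, E * e4 - e3 != 0 & e3 * e4 - E != 0].
Proof. exact: pants_neq d3 d4 flip_Po34 irrPo EV eo_yP eo_xP ex3 ey3 ex4. Qed.

Let r := ratio x1 y1.

Lemma flip_r :
  [/\ r x3 = r x2 * (e1 * (e3 - e1 * e2) / (e1 * e3 - e2)),
      r y2 = r x3 * ((e1 * e2 * e3 - 1) / (e1 * (e2 * e3 - e1))),
      r y3 = r x2 * (e1 * (1 - e1 * e2 * e3) / (e1 - e2 * e3)) & 
  [/\ r x4 = r x5 * (e1 * (e5 - e1 * e4) / (e1 * e5 - e4)),
      r y4 = r x5 * (e1 * (e4 * e5 - e1) / (e1 * e4 * e5 - 1))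
    & r y5 = r x4 * ((e1 - e4 * e5) / (e1 * (1 - e1 * e4 * e5)))]].
Proof.
have [e10 e20 e30 e40 e50] := flip_e_neq0.
have [n1 n2 n3 n4] := flip_n123; have [m1 m2 m3 m4] := flip_n145.
have [_ _ r3] := pants_ratio d2 d3 G123 irr1 e1V ex1 ey1 ex2 ex3.
have [_ _ r3'] := pants_ratio d2 d3 G123 irr1 e1V ex1 ey1 ey2 ex3.
have [_ _ ry3] := pants_ratio d2 d3 G123 irr1 e1V ex1 ey1 ex2 ey3.
have [_ _ r5] := pants_ratio d4 d5 Go45 irr1o e1V eo_y1 eo_x1 ex4 ex5.
have [_ _ r5'] := pants_ratio d4 d5 Go45 irr1o e1V eo_y1 eo_x1 ey4 ex5.
have [_ _ ry5] := pants_ratio d4 d5 Go45 irr1o e1V eo_y1 eo_x1 ex4 ey5.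
(* At the second vertex the eigenbasis is [(y1, x1)], whose coordinate is the inverse of [r]. *)
move: r5 r5' ry5; rewrite !(ratioV x1 y1) -/r.
move=> /(canRL (@invrK _)) r5 /(canRL (@invrK _)) r5' /(canRL (@invrK _)) ry5.
rewrite -/r in r3 r3' ry3.
split.
- by rewrite r3; congr (_ * _); field; nonzero.
- by rewrite r3'; field; nonzero.
- by rewrite ry3; field; nonzero.
split.
- by rewrite r5 invfM invrK; field; nonzero.
- by rewrite r5' invfM invrK; field; nonzero.
- by rewrite ry5 invfM invrK; field; nonzero.
Qed.

Let D0 : br x1 y1 != 0.
Proof. exact: eigenvector_br ex1 ey1 e1V. Qed.

Let br_base2 p e : eigenvector G2 e p -> br x1 p != 0 /\ br y1 p != 0.
Proof.
by move=> ep; split; [exact: (pants_br_neq0 G123 irr1 ex1 ep)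
                      |exact: (pants_br_neq0 G123 irr1 ey1 ep)].
Qed.

Let br_base3 p e : eigenvector G3 e p -> br x1 p != 0 /\ br y1 p != 0.
Proof.
by move=> ep; split; [exact: (pants_br_neq0_ac G123 irr1 ex1 ep)
                      |exact: (pants_br_neq0_ac G123 irr1 ey1 ep)].
Qed.

Let br_base4 p e : eigenvector G4 e p -> br x1 p != 0 /\ br y1 p != 0.
Proof.
by move=> ep; split; [exact: (pants_br_neq0 Go45 irr1o eo_x1 ep)
                      |exact: (pants_br_neq0 Go45 irr1o eo_y1 ep)].
Qed.

Let br_base5 p e : eigenvector G5 e p -> br x1 p != 0 /\ br y1 p != 0.
Proof.
by move=> ep; split; [exact: (pants_br_neq0_ac Go45 irr1o eo_x1 ep)
                      |exact: (pants_br_neq0_ac Go45 irr1o eo_y1 ep)].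
Qed.

Let rho_neq0 : r x2 != 0.
Proof. by have [xp yp] := br_base2 ex2; rewrite /r /ratio mulf_neq0 ?invr_eq0. Qed.

Let e11 : 1 - e1 * e1 != 0.
Proof. by rewrite -oppr_eq0 opprB subr_eq0 neq_inv_sqr. Qed.

Let t1_neq0 : t1 != 0.
Proof.
have [xp yp] := br_base5 ex5.
have : r x5 != 0 by rewrite /r /ratio mulf_neq0 ?invr_eq0.
by rewrite [r x5]tw1 mulf_eq0 oppr_eq0 negb_or => /andP[].
Qed.

(** The position of [xP] in the coordinate [r] is unknown. [pants_ratio] in the new pair of pants of
    [G2], [P], [G5] trades it for [x5], at the cost of the factor containing [E]. *)
Lemma flip_t2 t2 t2' : t2' * ratio x2 y2 xP = t2 * ratio x2 y2 x3 ->
  t2' = (e1 * e2 - e3) * (e1 * e3 - e2) * (t1 + 1)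
     / ((e2 * e3 - e1) * (e1 * e3 - e2) * t1
        + (1 - e1 * e2 * e3) * (e1 * e2 - e3))
     * ((e2 * E - e5) / (e2 * e5 - E)) * t2.
Proof.
have [e10 e20 e30 e40 e50] := flip_e_neq0; have E0 := flip_E0.
have [n1 n2 n3 n4] := flip_n123; have [k1 k2 k3 k4] := flip_nP52.
have G52P := pants_rot flip_P52; have irr52P := irreducible_rot irrP.
have G2P5 := pants_rot G52P; have irr2P5 := irreducible_rot irr52P.
have b25 : br x2 x5 != 0 := pants_br_neq0_ac G2P5 irr2P5 ex2 ex5.
have b25' : br y2 x5 != 0 := pants_br_neq0_ac G2P5 irr2P5 ey2 ex5.
have b2P : br x2 xP != 0 := pants_br_neq0 G2P5 irr2P5 ex2 exP.
have b2P' : br y2 xP != 0 := pants_br_neq0 G2P5 irr2P5 ey2 exP.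
have G231 := pants_rot G123; have irr231 := irreducible_rot irr1.
have b23 : br x2 x3 != 0 := pants_br_neq0 G231 irr231 ex2 ex3.
have [x12 _] := br_base2 ex2; have [x12' _] := br_base2 ey2.
have [x13 _] := br_base3 ex3; have [x15 _] := br_base5 ex5.
have [_ _ R5] := pants_ratio dP d5 G2P5 irr2P5 e2V ex2 ey2 exP ex5.
have := ratio_change D0 x12 x12' x15 b25; rewrite R5.
have := ratio_change D0 x12 x12' x13 b23.
have := ratio_sub_neq0 D0 x12' x15 b25'.
have := ratio_sub_neq0 D0 x12 x15 b25.
rewrite -/r; have [r3 ry2 _ _] := flip_r.
rewrite ry2 r3 [r x5]tw1 -/r.
set R1 := ratio x2 y2 x1.
have R10 : R1 != 0 by rewrite /R1 ratio_base mulf_neq0 ?invr_eq0.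
move: rho_neq0; set u := r x2 => u0 H1 H2 -> HP.
(* [t1 + 1 = 0] would make [x2] and [x5] the same point. *)
have t10 : t1 + 1 != 0.
  apply: contraNneq H1 => t10; rewrite (_ : _ - _ = - u * (t1 + 1)); last by ring.
  by rewrite t10 mulr0.
set Dn := (e2 * e3 - e1) * (e1 * e3 - e2) * t1 + (1 - e1 * e2 * e3) * (e1 * e2 - e3).
have DnE : - t1 * u - u * (e1 * (e3 - e1 * e2) / (e1 * e3 - e2)) *
    ((e1 * e2 * e3 - 1) / (e1 * (e2 * e3 - e1))) =
    - u * Dn / ((e2 * e3 - e1) * (e1 * e3 - e2)) by rewrite /Dn; field; nonzero.
(* Likewise [Dn] is, up to a nonzero factor, the difference of the coordinates of [x5] and [y2]. *)
have Dn0 : Dn != 0 by apply: contraNneq H2 => Dn0; rewrite DnE Dn0 mulr0 mul0r.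
have RP0 : ratio x2 y2 xP != 0 by rewrite /ratio mulf_neq0 ?invr_eq0.
have k0 : (e5 - e2 * E) / (e5 - E / e2) != 0.
  have -> : e5 - E / e2 = (e5 * e2 - E) / e2 by field.
  have k5 : e5 - e2 * E != 0 by nonzero.
  by rewrite !mulf_neq0 ?invr_eq0 ?mulf_neq0 ?invr_eq0.
move=> h; apply: (mulIf RP0); rewrite h.
have -> : ratio x2 y2 xP = R1 * (Dn / ((e2 * e3 - e1) * (e1 * e3 - e2) * (t1 + 1)))
    / ((e5 - e2 * E) / (e5 - E / e2)).
  by apply: (mulIf k0); rewrite HP divfK // DnE; field; nonzero.
have -> : u * (e1 * (e3 - e1 * e2) / (e1 * e3 - e2)) - u =
    u * e2 * (1 - e1 * e1) / (e1 * e3 - e2) by field; nonzero.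
by field; nonzero.
Qed.

(** Only fixed points of old curves occur, hence no [E] in the result. As [x1] is the pole of [r],
    its value [R1] is just the constant in [ratio_change] and cancels. *)
Lemma flip_t3 t3 t3' : t3' * ratio x3 y3 x4 = t3 * ratio x3 y3 x1 ->
  t3' = (e2 * e3 - e1) * ((e1 * e3 - e2) * (e1 * e4 - e5) * t1
                       + (e1 * e2 - e3) * (e1 * e5 - e4))
     / ((e1 * e3 - e2) * ((e2 * e3 - e1) * (e1 * e4 - e5) * t1
                          + (1 - e1 * e2 * e3) * (e1 * e5 - e4)))
     * t3.
Proof.
have [e10 e20 e30 e40 e50] := flip_e_neq0; have E0 := flip_E0.
have [n1 n2 n3 n4] := flip_n123; have [m1 m2 m3 m4] := flip_n145.
have G34o := pants_rot flip_Po34; have irr34o := irreducible_rot irrPo.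
have b34 : br x3 x4 != 0 := pants_br_neq0 G34o irr34o ex3 ex4.
have b34' : br y3 x4 != 0 := pants_br_neq0 G34o irr34o ey3 ex4.
have [x13 _] := br_base3 ex3; have [x13' _] := br_base3 ey3; have [x14 _] := br_base4 ex4.
have := ratio_change D0 x13 x13' x14 b34.
have := ratio_sub_neq0 D0 x13 x14 b34.
have := ratio_sub_neq0 D0 x13' x14 b34'.
have R0 : ratio x3 y3 x4 != 0 by rewrite /ratio mulf_neq0 ?invr_eq0.
rewrite -/r; have [r3 _ ry3 [r4 _ _]] := flip_r.
rewrite ry3 r3 r4 [r x5]tw1 -/r.
set R1 := ratio x3 y3 x1.
have R10 : R1 != 0 by rewrite /R1 ratio_base mulf_neq0 ?invr_eq0.
move: rho_neq0; set u := r x2 => u0.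
set Dn := (e2 * e3 - e1) * (e1 * e4 - e5) * t1 + (1 - e1 * e2 * e3) * (e1 * e5 - e4).
set Nn := (e1 * e3 - e2) * (e1 * e4 - e5) * t1 + (e1 * e2 - e3) * (e1 * e5 - e4).
have -> : - t1 * u * (e1 * (e5 - e1 * e4) / (e1 * e5 - e4)) -
    u * (e1 * (1 - e1 * e2 * e3) / (e1 - e2 * e3)) =
    u * e1 * Dn / ((e1 * e5 - e4) * (e2 * e3 - e1)) by rewrite /Dn; field; nonzero.
have -> : - t1 * u * (e1 * (e5 - e1 * e4) / (e1 * e5 - e4)) -
    u * (e1 * (e3 - e1 * e2) / (e1 * e3 - e2)) =
    u * e1 * Nn / ((e1 * e5 - e4) * (e1 * e3 - e2)) by rewrite /Nn; field; nonzero.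
move=> Dn0 Nn0 RE h.
have {}Dn0 : Dn != 0 by apply: contraNneq Dn0 => ->; rewrite mulr0 mul0r.
have {}Nn0 : Nn != 0 by apply: contraNneq Nn0 => ->; rewrite mulr0 mul0r.
by apply: (mulIf R0); rewrite h RE; field; nonzero.
Qed.

(** Again [xP] is eliminated, now as the fixed point of [Po] with eigenvalue [E^-1], against [x3] in
    the other new pair of pants. *)
Lemma flip_t4 t4 t4' : t4' * ratio x4 y4 xP = t4 * ratio x4 y4 x5 ->
  t4' = ((e1 * e3 - e2) * (e1 * e4 - e5) * t1 + (e1 * e2 - e3) * (e1 * e5 - e4))
     / ((e1 * e3 - e2) * (e4 * e5 - e1) * t1
        + (e1 * e2 - e3) * (1 - e1 * e4 * e5))
     * ((e3 * E - e4) / (1 - e3 * e4 * E)) * t4.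
Proof.
have [e10 e20 e30 e40 e50] := flip_e_neq0; have E0 := flip_E0.
have [n1 n2 n3 n4] := flip_n123; have [m1 m2 m3 m4] := flip_n145.
have [k1 k2 k3 k4] := flip_nPo34.
have G34o := pants_rot flip_Po34; have irr34o := irreducible_rot irrPo.
have G4o3 := pants_rot G34o; have irr4o3 := irreducible_rot irr34o.
have b43 : br x4 x3 != 0 := pants_br_neq0_ac G4o3 irr4o3 ex4 ex3.
have b43' : br y4 x3 != 0 := pants_br_neq0_ac G4o3 irr4o3 ey4 ex3.
have b4P : br x4 xP != 0 := pants_br_neq0 G4o3 irr4o3 ex4 eo_xP.
have b4P' : br y4 xP != 0 := pants_br_neq0 G4o3 irr4o3 ey4 eo_xP.
have G45o := pants_rot Go45; have irr45o := irreducible_rot irr1o.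
have b45 : br x4 x5 != 0 := pants_br_neq0 G45o irr45o ex4 ex5.
have [x14 _] := br_base4 ex4; have [x14' _] := br_base4 ey4.
have [x13 _] := br_base3 ex3; have [x15 _] := br_base5 ex5.
have [_ _ R3] := pants_ratio dPo d3 G4o3 irr4o3 e4V ex4 ey4 eo_xP ex3.
have := ratio_change D0 x14 x14' x13 b43; rewrite R3.
have := ratio_change D0 x14 x14' x15 b45.
have := ratio_sub_neq0 D0 x14' x13 b43'.
have := ratio_sub_neq0 D0 x14 x13 b43.
rewrite -/r; have [r3 _ _ [r4 ry4 _]] := flip_r.
rewrite ry4 r4 r3 [r x5]tw1 -/r.
set R1 := ratio x4 y4 x1.
have R10 : R1 != 0 by rewrite /R1 ratio_base mulf_neq0 ?invr_eq0.
move: rho_neq0; set u := r x2 => u0.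
set Dn := (e1 * e3 - e2) * (e4 * e5 - e1) * t1 + (e1 * e2 - e3) * (1 - e1 * e4 * e5).
set Nn := (e1 * e3 - e2) * (e1 * e4 - e5) * t1 + (e1 * e2 - e3) * (e1 * e5 - e4).
have -> : u * (e1 * (e3 - e1 * e2) / (e1 * e3 - e2)) -
    - t1 * u * (e1 * (e4 * e5 - e1) / (e1 * e4 * e5 - 1)) =
    u * e1 * Dn / ((e1 * e3 - e2) * (e1 * e4 * e5 - 1)) by rewrite /Dn; field; nonzero.
have -> : u * (e1 * (e3 - e1 * e2) / (e1 * e3 - e2)) -
    - t1 * u * (e1 * (e5 - e1 * e4) / (e1 * e5 - e4)) =
    - u * e1 * Nn / ((e1 * e3 - e2) * (e1 * e5 - e4)) by rewrite /Nn; field; nonzero.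
have -> : - t1 * u - - t1 * u * (e1 * (e4 * e5 - e1) / (e1 * e4 * e5 - 1)) =
    t1 * u * (1 - e1 * e1) / (e1 * e4 * e5 - 1) by field; nonzero.
have -> : - t1 * u - - t1 * u * (e1 * (e5 - e1 * e4) / (e1 * e5 - e4)) =
    t1 * u * e4 * (1 - e1 * e1) / (e1 * e5 - e4) by field; nonzero.
move=> Nn0 Dn0 R5 RE h.
have {}Dn0 : Dn != 0 by apply: contraNneq Dn0 => ->; rewrite mulr0 mul0r.
have {}Nn0 : Nn != 0 by apply: contraNneq Nn0 => ->; rewrite mulr0 mul0r.
have RP0 : ratio x4 y4 xP != 0 by rewrite /ratio mulf_neq0 ?invr_eq0.
have q1 : (e3 - e4 / E) / (e3 - E^-1 / e4) =
    e4 * (e3 * E - e4) / (e3 * e4 * E - 1) by field; nonzero.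
have q2 : e3 * E - e4 != 0 by rewrite mulrC.
have q3 : e3 * e4 * E - 1 != 0 by nonzero.
have q0 : e4 * (e3 * E - e4) / (e3 * e4 * E - 1) != 0.
  by rewrite !mulf_neq0 ?invr_eq0.
rewrite q1 in RE; apply: (mulIf RP0); rewrite h R5.
rewrite -[ratio x4 y4 xP](mulfK q0) RE.
by field; nonzero.
Qed.

(** As for [flip_t3], all points are old and the value at [x1] cancels. *)
Lemma flip_t5 t5 t5' : t5' * ratio x5 y5 x2 = t5 * ratio x5 y5 x1 ->
  t5' = (e1 * e5 - e4) * (e1 * e4 * e5 - 1) * (t1 + 1)
     / ((e1 - e4 * e5) * (e1 * e4 - e5) * t1
        + (e1 * e4 * e5 - 1) * (e1 * e5 - e4))
     * t5.
Proof.
have [e10 e20 e30 e40 e50] := flip_e_neq0; have E0 := flip_E0.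
have [n1 n2 n3 n4] := flip_n123; have [m1 m2 m3 m4] := flip_n145.
have G52P := pants_rot flip_P52; have irr52P := irreducible_rot irrP.
have b52 : br x5 x2 != 0 := pants_br_neq0 G52P irr52P ex5 ex2.
have b52' : br y5 x2 != 0 := pants_br_neq0 G52P irr52P ey5 ex2.
have [x15 _] := br_base5 ex5; have [x15' _] := br_base5 ey5; have [x12 _] := br_base2 ex2.
have := ratio_change D0 x15 x15' x12 b52.
have := ratio_sub_neq0 D0 x15 x12 b52.
have := ratio_sub_neq0 D0 x15' x12 b52'.
have R0 : ratio x5 y5 x2 != 0 by rewrite /ratio mulf_neq0 ?invr_eq0.
rewrite -/r; have [_ _ _ [r4 _ ry5]] := flip_r.
rewrite ry5 r4 [r x5]tw1 -/r.
set R1 := ratio x5 y5 x1.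
have R10 : R1 != 0 by rewrite /R1 ratio_base mulf_neq0 ?invr_eq0.
move: rho_neq0; set u := r x2 => u0.
set Dn := (e1 - e4 * e5) * (e1 * e4 - e5) * t1 + (e1 * e4 * e5 - 1) * (e1 * e5 - e4).
have -> : u - - t1 * u * (e1 * (e5 - e1 * e4) / (e1 * e5 - e4)) *
    ((e1 - e4 * e5) / (e1 * (1 - e1 * e4 * e5))) =
    u * Dn / ((e1 * e5 - e4) * (e1 * e4 * e5 - 1)) by rewrite /Dn; field; nonzero.
have -> : u - - t1 * u = u * (t1 + 1) by ring.
move=> Dn0; rewrite mulf_eq0 negb_or => /andP[_ t10] RE h.
have {}Dn0 : Dn != 0 by apply: contraNneq Dn0 => ->; rewrite mulr0 mul0r.
by apply: (mulIf R0); rewrite h RE; field; nonzero.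
Qed.

(** Applying [P - E] to [x] leaves only its component along [yP], and [P - E^-1] only the one along
    [xP]. The quotient of the components is the coordinate of [x], and the factor
    [br z yP / br z xP] is the same for all [x]. *)
Lemma eigen_functional x z : br xP yP != 0 -> br xP x != 0 -> br z xP != 0 ->
  ratio xP yP x * (br z (P *m x) - E * br z x) =
  br z yP / br z xP * (br z (P *m x) - E^-1 * br z x).
Proof.
move=> D xPx zxP.
have [_ Px] := exP; have [_ Py] := eyP.
have E1 : br xP yP * br z (P *m x) =
    br x yP * (E * br z xP) + br xP x * (E^-1 * br z yP).
  rewrite -!brZr scalemxAr (br_span xP yP x) mulmxDr -!scalemxAr Px Py.
  by rewrite /br !mxE; ring.
have E2 : br xP yP * br z x = br x yP * br z xP + br xP x * br z yP.
  by rewrite -brZr br_span /br !mxE; ring.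
apply: (mulfI D).
transitivity (ratio xP yP x * (br xP yP * br z (P *m x) - E * (br xP yP * br z x))).
  by ring.
transitivity (br z yP / br z xP * (br xP yP * br z (P *m x) - E^-1 * (br xP yP * br z x))).
  by rewrite E1 E2 /ratio (brC x yP); field; rewrite zxP xPx flip_E0.
by ring.
Qed.

Lemma flip_tw1_br : br y1 x5 * br x1 x2 = - t1 * br y1 x2 * br x1 x5.
Proof.
have [x12 _] := br_base2 ex2; have [x15 _] := br_base5 ex5.
by rewrite -[br y1 x5](divfK x15) -/(ratio x1 y1 x5) tw1 /ratio; field.
Qed.

Definition flip_traces :=
  let: conj _ tr2 := eigenvector_char d2 ex2 in let: conj _ tr3 := eigenvector_char d3 ex3 in
  let: conj _ tr4 := eigenvector_char d4 ex4 in let: conj _ tr5 := eigenvector_char d5 ex5 in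
  quad_traces d1 d2 d3 d4 d5 G123 flip_45 tr2 tr3 tr4 tr5 e1V
    (neq_inv_neq0 e2V) (neq_inv_neq0 e3V) (neq_inv_neq0 e4V) (neq_inv_neq0 e5V)
    ex1 ey1 ex2 ex5 (proj1 (br_base2 ex2)) (proj2 (br_base2 ex2))
    (proj1 (br_base5 ex5)) (proj2 (br_base5 ex5))
    flip_tw1_br.

(** * The twist parameter of the new edge *)

Section Twist1.
Variable t1' : F.
Hypothesis tw1' : ratio xP yP x4 = - t1' * ratio xP yP x5.

(** Both traces are combinations of [t1'] and [t1'^-1]. In [E * \tr (G3 *m G5) - E^-1 * \tr (G2 *m
    G4)] the terms in [t1'^-1] cancel, and [t1'] keeps the coefficient [E ^+ 2 - E^-1 ^+ 2] up to
    factors from (C1) and (C2); this is where [E ^+ 2 != -1] is needed. *)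
Lemma flip_t1_trace : E ^+ 2 != -1 ->
  t1' = 1 / (E + E^-1)
     * (E * e5 * e2 / ((e5 * e2 - E) * (E * e2 - e5)))
     * (E * e3 * e4 / ((e3 * e4 - E) * (E * e3 - e4)))
     * ((E - E^-1) * (E * \tr (G3 *m G5) - E^-1 * \tr (G2 *m G4))
        - (E + E^-1) * ((e2 + e2^-1) * (e3 + e3^-1) + (e4 + e4^-1) * (e5 + e5^-1))
        + 2 * ((e3 + e3^-1) * (e5 + e5^-1) + (e2 + e2^-1) * (e4 + e4^-1))).
Proof.
have [e10 e20 e30 e40 e50] := flip_e_neq0; have E0 := flip_E0.
have [h1 h2 h3 h4] := flip_nPo34; have [k1 k2 k3 k4] := flip_nP52.
have P52 := flip_P52; have oP34 := flip_Po34.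
have xP5 : br xP x5 != 0 := pants_br_neq0 P52 irrP exP ex5.
have yP5 : br yP x5 != 0 := pants_br_neq0 P52 irrP eyP ex5.
have xP4 : br xP x4 != 0 := pants_br_neq0_ac oP34 irrPo eo_xP ex4.
have yP4 : br yP x4 != 0 := pants_br_neq0_ac oP34 irrPo eo_yP ex4.
have tw : br yP x4 * br xP x5 = - t1' * br yP x5 * br xP x4.
  rewrite -[br yP x4](divfK xP4) -/(ratio xP yP x4) tw1' /ratio; field; exact: xP5.
have t0 : t1' != 0.
  by apply: contraNneq (mulf_neq0 yP4 xP5) => t0; rewrite tw t0 oppr0 !mul0r.
have [_ Tr2] := eigenvector_char d2 ex2; have [_ Tr3] := eigenvector_char d3 ex3.
have [_ Tr4] := eigenvector_char d4 ex4; have [_ Tr5] := eigenvector_char d5 ex5.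
have [_ T35 T24] := quad_traces dP d5 d2 d3 d4 P52 (esym defP) Tr5 Tr2 Tr3 Tr4 EV
  e50 e20 e30 e40 exP eyP ex5 ex4 xP5 yP5 xP4 yP4 tw.
move=> E2; rewrite (mxtrace_mulC G3).
have w0 : E * E - 1 != 0 by rewrite subr_eq0 neq_inv_sqr.
have w20 : (E - E^-1) ^+ 2 != 0.
  by rewrite expf_neq0 // subr_eq0.
have s0 : E * E + 1 != 0 by rewrite addr_eq0 -expr2.
rewrite -[\tr (G5 *m G3)](mulKf w20) T35 -[\tr (G2 *m G4)](mulKf w20) T24.
field; nonzero.
Qed.

(** [eigen_functional] with [z = x3] at [x4] and at [x5] has the same unknown factor [kap], which
    cancels in the quotient defining [t1']. *)
Lemma flip_t1 :
  t1' = ((e4 * E - e3)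
      * (e3 * e5 * (- (e1 * e3 - e2) * t1 + e1 * (e1 * e2 - e3)) * E
         + e1 * (e1 * e3 - e2) * t1 - (e1 * e2 - e3)))
     / ((e3 * E - e4)
        * ((e1 * (e1 * e3 - e2) * t1 - (e1 * e2 - e3)) * E
           + e3 * e5 * (- (e1 * e3 - e2) * t1 + e1 * (e1 * e2 - e3)))).
Proof.
have [e10 e20 e30 e40 e50] := flip_e_neq0; have E0 := flip_E0.
have [n1 n2 n3 n4] := flip_n123.
have [h1 h2 h3 h4] := flip_nPo34; have [k1 k2 k3 k4] := flip_nP52.
have P52 := flip_P52; have oP34 := flip_Po34.
have xP5 : br xP x5 != 0 := pants_br_neq0 P52 irrP exP ex5.
have yP5 : br yP x5 != 0 := pants_br_neq0 P52 irrP eyP ex5.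
have xP3 : br x3 xP != 0 by rewrite brC oppr_eq0; exact: (pants_br_neq0 oP34 irrPo eo_xP ex3).
have yP3 : br x3 yP != 0 by rewrite brC oppr_eq0; exact: (pants_br_neq0 oP34 irrPo eo_yP ex3).
have xP4 : br xP x4 != 0 := pants_br_neq0_ac oP34 irrPo eo_xP ex4.
have x34 : br x3 x4 != 0 := pants_br_neq0 (pants_rot oP34) (irreducible_rot irrPo) ex3 ex4.
have DP : br xP yP != 0 := eigenvector_br exP eyP EV.
have [x13 _] := br_base3 ex3; have [x15 _] := br_base5 ex5.
(* This motivates [z = x3]: pairing with [x3] removes [G3] from [P = G3 G4]. What remains is known,
   as [G4 x4 = e4 x4] and [e5 G4 x5 = G1 x5]. *)
have G3x x : br x3 (G3 *m x) = e3^-1 * br x3 x.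
  by apply: (mulfI e30); rewrite -brZl; have [_ <-] := ex3; rewrite br_mul d3 mul1r mulVKf.
have Px4 : br x3 (P *m x4) = e3^-1 * e4 * br x3 x4.
  by rewrite defP -mulmxA G3x; have [_ ->] := ex4; rewrite brZr mulrA.
have Px5 : br x3 (P *m x5) = (e3 * e5)^-1 * br x3 (G1 *m x5).
  rewrite defP -mulmxA G3x -flip_45 -mulmxA; have [_ ->] := ex5.
  by rewrite -scalemxAr brZr; field; rewrite e30 e50.
have G1x5 : br x1 y1 * br x3 (G1 *m x5) =
    br x1 x3 * br x1 x5 * (e1 * r x5 - e1^-1 * r x3).
  rewrite -brZr scalemxAr (br_span x1 y1 x5) mulmxDr -!scalemxAr.
  have [_ ->] := ex1; have [_ ->] := ey1.
  by rewrite /r /ratio /br !mxE; field; rewrite -!/(br _ _) x13 x15 e10.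
have x35 := br_ratio y1 x13 x15; rewrite -/(r x3) -/(r x5) in x35.
have F4 := eigen_functional DP xP4 xP3; have F5 := eigen_functional DP xP5 xP3.
set kap := br x3 yP / br x3 xP in F4 F5.
have kap0 : kap != 0 by rewrite /kap mulf_neq0 ?invr_eq0.
have {}F4 : ratio xP yP x4 * (e4 - e3 * E) = kap * (e4 - e3 * E^-1).
  apply: (mulIf x34); apply: (mulIf (invr_neq0 e30)).
  transitivity (ratio xP yP x4 * (br x3 (P *m x4) - E * br x3 x4)).
    by rewrite Px4; field.
  by rewrite F4 Px4; field; nonzero.
(* The functional [br x3 ((P - e) x5)] in the coordinate [r], up to a nonzero factor independent of
   [e]. *)
pose psi e := (e3 * e5)^-1 * (e1 * r x5 - e1^-1 * r x3) - e * (r x5 - r x3).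
have psiE e : br x1 y1 * (br x3 (P *m x5) - e * br x3 x5) = br x1 x3 * br x1 x5 * psi e.
  transitivity ((e3 * e5)^-1 * (br x1 y1 * br x3 (G1 *m x5)) - e * (br x1 y1 * br x3 x5)).
    by rewrite Px5; ring.
  by rewrite G1x5 x35 /psi; ring.
have {}F5 : ratio xP yP x5 * psi E = kap * psi E^-1.
  apply: (mulfI (mulf_neq0 x13 x15)).
  transitivity (ratio xP yP x5 * (br x1 x3 * br x1 x5 * psi E)); first by ring.
  transitivity (kap * (br x1 x3 * br x1 x5 * psi E^-1)); last by ring.
  by rewrite -!psiE mulrCA F5 mulrCA.
have R50 : ratio xP yP x5 != 0 by rewrite /ratio mulf_neq0 ?invr_eq0.
have [r3 _ _ _] := flip_r.
set A := e3 * e5 * (- (e1 * e3 - e2) * t1 + e1 * (e1 * e2 - e3)).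
set B := e1 * (e1 * e3 - e2) * t1 - (e1 * e2 - e3).
move: rho_neq0; set u := r x2 => u0.
have psiAB e : psi e = - u / ((e1 * e3 - e2) * e3 * e5) * (B + e * A).
  by rewrite /psi r3 [r x5]tw1 -/r -/u /A /B; field; nonzero.
(* Both equations force [A = B = 0] since [E * E != 1], but [e1 * A + e3 * e5 * B] is a product of
   nonzero factors. With [F5] this makes the denominator [B * E + A] nonzero. *)
have AB : A * E + B = 0 -> B * E + A = 0 -> False.
  move=> AB1 AB2.
  have w0 : E * E - 1 != 0 by rewrite subr_eq0 neq_inv_sqr.
  have B0 : B = 0.
    apply: (mulIf w0); transitivity ((B * E + A) * E - (A * E + B)); first by ring.
    by rewrite AB1 AB2; ring.
  have A0 : A = 0 by move: AB2; rewrite B0 mul0r add0r.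
  case/negP: (mulf_neq0 (mulf_neq0 (mulf_neq0 e30 e50) e11) n2); apply/eqP.
  by transitivity (- (e1 * A + e3 * e5 * B)); [rewrite /A /B; ring | rewrite A0 B0; ring].
have c0 : - u / ((e1 * e3 - e2) * e3 * e5) != 0.
  by rewrite !mulf_neq0 ?invr_eq0 ?mulf_neq0 ?oppr_eq0.
have {}F5 : ratio xP yP x5 * (A * E + B) * E = kap * (B * E + A).
  apply: (mulfI c0).
  transitivity (ratio xP yP x5 * (- u / ((e1 * e3 - e2) * e3 * e5) * (B + E * A)) * E).
    by ring.
  by rewrite -psiAB F5 psiAB; field; nonzero.
have BEA : B * E + A != 0.
  apply/eqP=> H; apply: (AB) => //.
  by apply: (mulfI R50); apply: (mulIf E0); rewrite F5 H !mulr0 mul0r.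
transitivity ((e4 * E - e3) * (A * E + B) / ((e3 * E - e4) * (B * E + A))); last by rewrite addrA.
have e43 : e3 * E - e4 != 0 by rewrite mulrC.
have key : t1' * (e4 - e3 * E) * (B * E + A) = - (e4 * E - e3) * (A * E + B).
  apply: (mulIf (mulf_neq0 kap0 R50)).
  transitivity (- ((- t1' * ratio xP yP x5) * (e4 - e3 * E)) * (kap * (B * E + A))).
    by ring.
  by rewrite -tw1' F4 -F5; field.
apply: (mulIf (mulf_neq0 e43 BEA)); rewrite divfK ?mulf_neq0 //.
by apply/eqP; rewrite -eqr_opp -[X in _ == X]mulNr -key; apply/eqP; ring.
Qed.
End Twist1.
End Flip.

(** * Twist parameters as cross-ratios *)

Section Twist.
Variable F : numClosedFieldType.
Implicit Types (A B G M : 'M[F]_2) (X Y x y z p q : 'cV[F]_2) (a b c s t : F).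

Lemma eigenvector_exists M a : \det M = 1 -> eigenvalue M a ->
  (exists x, eigenvector M a x) /\ (exists y, eigenvector M a^-1 y).
Proof.
move=> dM ea.
have ex b : b ^+ 2 - \tr M * b + 1 = 0 -> exists x, eigenvector M b x.
  (* [eigenvalue] refers to row vectors; the transpose produces a column. *)
  move=> ch; have : eigenvalue M^T b.
    rewrite eigenvalue_root_char /root /char_poly det_mx2 !mxE /=.
    rewrite !(hornerE, mulr1n, mulr0n) -ch; apply/eqP.
    by rewrite -[X in _ = _ + X]dM det_mx2 mxtrace2; ring.
  case/eigenvalueP=> v vM v0; exists v^T; split.
    by apply: contraNneq v0 => vT; rewrite -[v]trmxK vT trmx0.
  by rewrite -[M]trmxK -trmx_mul vM linearZ.
have ch := eigenvalue_char dM ea.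
have a0 : a != 0.
  by apply/eqP=> a0; move/eqP: ch; rewrite a0 expr0n mulr0 subr0 add0r oner_eq0.
split; first exact: ex.
apply: ex; apply: (mulfI (expf_neq0 2 a0)); rewrite mulr0 -ch; field.
exact: a0.
Qed.

(** The definition supplies some eigenvectors. Eigenvectors are unique up to a scalar and the
    relation is homogeneous in each, so it holds for every choice. *)
Lemma twist_br A B G a b c t X Y p q :
  \det A = 1 -> \det B = 1 -> \det G = 1 -> a != a^-1 -> b != b^-1 -> c != c^-1 ->
  t != 0 ->
  (exists x1 y1 x2 x5 : 'cV[F]_2, exists M : 'M[F]_2,
    [/\ eigenvector A a x1, eigenvector A a^-1 y1, eigenvector B b x2
      & eigenvector G c x5]
    /\ [/\ M *m x1 = sqrtC (- t) *: x1, M *m y1 = (sqrtC (- t))^-1 *: y1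
         & same_pt (M *m x2) x5]) ->
  eigenvector A a X -> eigenvector A a^-1 Y -> eigenvector B b p -> eigenvector G c q ->
  br Y q * br X p = - t * br Y p * br X q.
Proof.
move=> dA dB dG aV bV cV t0 [x1 [y1 [x2 [x5 [M [[ex1 ey1 ex2 ex5] [Mx My Mp]]]]]]] eX eY ep eq.
have [k1 k10 Dx] := eigenvector_unique dA aV eX ex1.
have [k2 k20 Dy] := eigenvector_unique dA (inv_neq_inv aV) eY ey1.
have [k3 k30 Dp] := eigenvector_unique dB bV ep ex2.
have [k4 k40 Dq] := eigenvector_unique dG cV eq ex5.
have s0 : sqrtC (- t) != 0 by rewrite sqrtC_eq0 oppr_eq0.
have := twist_br_mx s0 (eigenvector_br ex1 ey1 aV) Mx My Mp.
rewrite sqrtCK Dx Dy Dp Dq !brZl !brZr => E.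
apply: (mulfI (mulf_neq0 (mulf_neq0 k10 k20) (mulf_neq0 k30 k40))).
transitivity (k2 * (k4 * br Y q) * (k1 * (k3 * br X p))); first by ring.
by rewrite E; ring.
Qed.

Lemma twist_compare X Y p p' q t t' : br X Y != 0 -> q != 0 ->
  br X p != 0 -> br X p' != 0 ->
  br Y q * br X p = - t * br Y p * br X q ->
  br Y q * br X p' = - t' * br Y p' * br X q ->
  t' * ratio X Y p' = t * ratio X Y p.
Proof.
move=> XY q0 Xp Xp' E E'.
have Xq : br X q != 0.
  apply: contraNneq q0 => Xq; move: E; rewrite Xq mulr0 => /eqP.
  rewrite mulf_eq0 (negbTE Xp) orbF => /eqP Yq.
  by apply/eqP/(scalerI XY); rewrite br_span (brC q) Yq Xq oppr0 !scale0r addr0 scaler0.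
rewrite /ratio; apply: (mulIf Xp'); apply: (mulIf Xp); apply: (mulIf Xq).
apply: oppr_inj.
transitivity ((- t' * br Y p' * br X q) * br X p); first by field.
by rewrite -E' mulrAC E; field.
Qed.

Lemma twist_ratio X Y p q t : br X p != 0 -> br X q != 0 ->
  br Y q * br X p = - t * br Y p * br X q -> ratio X Y q = - t * ratio X Y p.
Proof.
move=> Xp Xq E; rewrite /ratio; apply: (mulIf Xq); rewrite divfK //.
by apply: (mulIf Xp); rewrite E; field.
Qed.
End Twist.

(** * Edge paths and holonomy *)

Definition along (C : numClosedFieldType) (H : finType) (rho : seq (step H) -> 'M[C]_2)
  (d w : seq (step H)) : 'M[C]_2 := rho (d ++ w ++ inv_path d).

Section Paths.
Variables (H : finType) (S : dual_graph H).
Hypothesis hS : dual_graph_axioms S.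
Implicit Types (f h : H) (s : step H) (u v w k d : seq (step H)) (x y z p q : point H).

Lemma inv_stepK : involutive (@inv_step H).
Proof. by case=> h b /=; rewrite negbK. Qed.

Lemma inv_path_cat u v : inv_path (u ++ v) = inv_path v ++ inv_path u.
Proof. by rewrite /inv_path rev_cat map_cat. Qed.

Lemma inv_path_cons s u : inv_path (s :: u) = inv_path u ++ [:: inv_step s].
Proof. by rewrite -cat1s inv_path_cat. Qed.

Lemma inv_pathK : involutive (@inv_path H).
Proof.
elim=> [|s u IH] //; rewrite inv_path_cons inv_path_cat IH /inv_path /=.
by rewrite inv_stepK.
Qed.

Lemma is_path_cat x y z u v :
  is_path S x u y -> is_path S y v z -> is_path S x (u ++ v) z.
Proof.
elim: u x => [|s u IH] x /=; first by move/eqP->.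
by case/andP=> -> /= /IH; apply.
Qed.

Lemma is_path_catP x z u v : is_path S x (u ++ v) z ->
  exists2 y, is_path S x u y & is_path S y v z.
Proof.
elim: u x => [|s u IH] x /=; first by exists x.
by case/andP=> -> /IH [y uy vz]; exists y.
Qed.

Lemma is_path_inv x y w : is_path S x w y -> is_path S y (inv_path w) x.
Proof.
elim: w x => [|s w IH] x /=; first by rewrite eq_sym.
case/andP=> /eqP <- /IH wy; rewrite inv_path_cons; apply: (is_path_cat wy).
by rewrite /= /target inv_stepK !eqxx.
Qed.

Lemma is_path_cancel x y u s v :
  is_path S x (u ++ s :: inv_step s :: v) y -> is_path S x (u ++ v) y.
Proof.
case/is_path_catP=> z xu /= /and3P [/eqP sz _].
by rewrite /target inv_stepK sz; apply: is_path_cat.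
Qed.

Lemma vertex_nxt h : vertex S (nxt S h) = vertex S h.
Proof. by case: hS => n3 _ _ _; rewrite /vertex n3 setUC setUA. Qed.

Lemma edge_mate h : edge S (mate S h) = edge S h.
Proof. by case: hS => _ _ m _; rewrite /edge m setUC. Qed.

Lemma is_loop_lasso f h : vertex S h = vertex S f -> is_loop S (pt_edge S f) (lasso f h).
Proof. by move=> E; rewrite /is_loop /= /target /= /pt_vertex E !eqxx. Qed.

Lemma realize_standard w : realize (standard S) w = w.
Proof. by elim: w => //= s w {2}<-. Qed.

Lemma realize_cat (D : pants_decomposition H) u v :
  realize D (u ++ v) = realize D u ++ realize D v.
Proof. by rewrite /realize map_cat flatten_cat. Qed.

Section Rep.
Variables (C : numClosedFieldType) (x0 : point H) (rho : seq (step H) -> 'M[C]_2).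
Hypothesis hrho : is_representation S x0 rho.

Local Notation W := (along rho).

Lemma rho_cancel u s v : is_loop S x0 (u ++ s :: inv_step s :: v) ->
  rho (u ++ s :: inv_step s :: v) = rho (u ++ v).
Proof.
case: hrho => _ _ he L; apply: he => //; first exact: is_path_cancel L.
exact: Elem_cancel.
Qed.

Lemma rho_cancel_path u k v : is_loop S x0 (u ++ k ++ inv_path k ++ v) ->
  rho (u ++ k ++ inv_path k ++ v) = rho (u ++ v).
Proof.
elim: k u v => [|s k IH] u v //=.
rewrite inv_path_cons -!catA /= -cat_rcons => L.
rewrite IH // cat_rcons rho_cancel // -cat_rcons.
case/is_path_catP: L => z xz /is_path_catP [z1 zk] /is_path_catP [z2 zk' zv].
rewrite /is_loop; apply: (is_path_cat xz); move: zv.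
(* A word and its starting point determine the end point, so [inv_path k] leads back to [z]. *)
suff -> : z2 = z by [].
have := is_path_inv zk; move: zk'; elim: (inv_path k) z1 {zk} => [|s' w IHw] z1 /=.
  by move/eqP<- => /eqP.
by case/andP=> _ p1 /andP [_ p2]; apply: IHw p1 p2.
Qed.

Lemma is_loop_conj d p w : is_path S x0 d p -> is_loop S p w ->
  is_loop S x0 (d ++ w ++ inv_path d).
Proof.
move=> dp pw; apply: (is_path_cat dp).
exact: (is_path_cat pw (is_path_inv dp)).
Qed.

Lemma hol_det d p w : is_path S x0 d p -> is_loop S p w -> \det (W d w) = 1.
Proof. by move=> dp pw; case: hrho => det1 _ _; apply/det1/(is_loop_conj dp). Qed.

Lemma hol_cat d p u v : is_path S x0 d p -> is_loop S p u -> is_loop S p v ->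
  W d (u ++ v) = W d u *m W d v.
Proof.
move=> dp pu pv; case: hrho => _ mul _.
rewrite /along -mul; [|exact: is_loop_conj pu|exact: is_loop_conj pv].
have := @rho_cancel_path (d ++ u) (inv_path d) (v ++ inv_path d).
rewrite inv_pathK -!catA => ->//.
rewrite /is_loop; apply: (is_path_cat dp); apply: (is_path_cat pu).
apply: (is_path_cat (is_path_inv dp)); apply: (is_path_cat dp).
exact: (is_path_cat pv (is_path_inv dp)).
Qed.

(** The value is idempotent by multiplicativity, and invertible since its determinant is 1. *)
Lemma hol_nil d p : is_path S x0 d p -> W d [::] = 1%:M.
Proof.
move=> dp; have l0 : is_loop S p [::] := eqxx p.
have d1 := hol_det dp l0; have := hol_cat dp l0 l0 => /= W2.
have U : W d [::] \in unitmx by rewrite unitmxE d1 unitr1.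
by rewrite -(mulVmx U) {3}W2 mulKmx.
Qed.

Lemma hol_inv d p w : is_path S x0 d p -> is_loop S p w ->
  W d w *m W d (inv_path w) = 1%:M.
Proof.
move=> dp pw; rewrite -(hol_cat dp) // -?(hol_nil dp); last exact: is_path_inv.
have := @rho_cancel_path d w (inv_path d); rewrite /along -!catA => -> //.
rewrite /is_loop; apply: (is_path_cat dp); apply: (is_path_cat pw).
exact: (is_path_cat (is_path_inv pw) (is_path_inv dp)).
Qed.

Lemma hol_change d k w : W (d ++ k) w = W d (k ++ w ++ inv_path k).
Proof. by rewrite /along inv_path_cat -!catA. Qed.

Lemma hol_cancel d p u s v : is_path S x0 d p ->
  is_loop S p (u ++ s :: inv_step s :: v) ->
  W d (u ++ s :: inv_step s :: v) = W d (u ++ v).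
Proof.
move=> dp L; have := is_loop_conj dp L; rewrite /along -!catA /= catA => L'.
by rewrite rho_cancel // -catA.
Qed.

(** Moving the base point along [k] undoes conjugation by [k]. New loops based at f2, ..., f5 are
    realized as such conjugates. *)
Lemma hol_conj d p q k w : is_path S x0 d p -> is_path S p k q -> is_loop S p w ->
  W (d ++ k) (inv_path k ++ w ++ k) = W d w.
Proof.
move=> dp pk pw; rewrite hol_change.
have l : is_loop S p (k ++ inv_path k) := is_path_cat pk (is_path_inv pk).
have W1 : W d (k ++ inv_path k) = 1%:M.
  by have := @rho_cancel_path d k (inv_path d); rewrite /along -!catA => ->;
    [exact: hol_nil dp | have := is_loop_conj dp l; rewrite -!catA].
rewrite -!catA catA (hol_cat dp l) ?W1 ?mul1mx; last exact: (is_path_cat pw l).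
by rewrite (hol_cat dp pw l) W1 mulmx1.
Qed.

Lemma hol_lasso_self d f : is_path S x0 d (pt_edge S f) ->
  W d (lasso f f) = W d [:: Around f false].
Proof.
move=> dp; have L := is_loop_lasso (erefl (vertex S f)).
rewrite /lasso in L *; rewrite (hol_cancel (u := [::]) (s := Along f true) dp) //=.
rewrite (hol_cancel (u := [:: Around f false]) (s := Along f true) (v := [::]) dp) //=.
by rewrite /is_loop /= /target /= !eqxx.
Qed.

Lemma hol_lasso_change d f f' h : is_path S x0 d (pt_edge S f) ->
  vertex S f' = vertex S f -> vertex S h = vertex S f ->
  W (d ++ [:: Along f true; Along f' false]) (lasso f' h) = W d (lasso f h).
Proof.
move=> dp Ef Eh; rewrite hol_change /lasso /=.
have L : is_loop S (pt_edge S f)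
   ([:: Along f true] ++ Along f' false :: Along f' true :: [:: Along h false; Around h false;
     Along h true; Along f' false; Along f' true; Along f false]).
  by rewrite /is_loop /= /target /= /pt_vertex Ef Eh !eqxx.
rewrite (hol_cancel (u := [:: Along f true]) (s := Along f' false) dp L).
have L2 := is_path_cancel L.
exact: (hol_cancel (u := [:: Along f true; Along h false; Around h false; Along h true])
  (s := Along f' false) (v := [:: Along f false]) dp L2).
Qed.

Lemma hol_lasso_around d f h :
  W d (lasso f h) = W (d ++ [:: Along f true; Along h false]) [:: Around h false].
Proof. by rewrite hol_change. Qed.

(** Once the detours along [f] are cancelled, the product of the lassos is the boundary word of the
    2-cell, conjugated by [Along f]. *)
Lemma hol_lasso_prod d f : is_path S x0 d (pt_edge S f) ->
  W d (lasso f f) *m W d (lasso f (nxt S f)) *m W d (lasso f (nxt S (nxt S f))) = 1%:M.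
Proof.
move=> dp; set f2 := nxt S f; set f3 := nxt S f2.
have E2 : vertex S f2 = vertex S f by rewrite vertex_nxt.
have E3 : vertex S f3 = vertex S f by rewrite vertex_nxt.
have l1 := is_loop_lasso (erefl (vertex S f)).
have l2 := is_loop_lasso E2; have l3 := is_loop_lasso E3.
have l12 : is_loop S (pt_edge S f) (lasso f f ++ lasso f f2) := is_path_cat l1 l2.
have l123 : is_loop S (pt_edge S f) ((lasso f f ++ lasso f f2) ++ lasso f f3).
  exact: (is_path_cat l12 l3).
rewrite -(hol_cat dp l1 l2) -(hol_cat dp l12 l3).
rewrite /lasso /=.
have loops := (E2, E3, eqxx).
rewrite (hol_cancel (u := [:: Along f true; Along f false; Around f false; Along f true])
  (s := Along f false) dp) /=; last by rewrite /is_loop /= /target /= /pt_vertex !loops.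
rewrite (hol_cancel (u := [:: Along f true; Along f false; Around f false; Along f true;
    Along f2 false; Around f2 false; Along f2 true]) (s := Along f false) dp) /=;
  last by rewrite /is_loop /= /target /= /pt_vertex !loops.
have l0 : is_loop S (pt_edge S f) [:: Along f true; Along f false].
  by rewrite /is_loop /= /target /= !eqxx.
transitivity (W d [:: Along f true; Along f false]).
  case: hrho => _ _; apply; [apply: (is_loop_conj dp)|exact: is_loop_conj l0|].
    by rewrite /is_loop /= /target /= /pt_vertex !loops.
  have := @Elem_pants H S (d ++ [:: Along f true]) f (Along f false :: inv_path d).
  by rewrite /pants_word -!catA.
by rewrite (hol_cancel (u := [::]) (s := Along f true) dp l0) (hol_nil dp).
Qed.

Lemma hol_glue d f : interior S f -> is_path S x0 d (pt_edge S f) ->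
  W d [:: Around f false] *m W d [:: Around (mate S f) false] = 1%:M.
Proof.
move=> If dp; have pE : pt_edge S (mate S f) = pt_edge S f by rewrite /pt_edge edge_mate.
have l b : is_loop S (pt_edge S f) [:: Around f b].
  by rewrite /is_loop /= /target /= !eqxx.
have l' b : is_loop S (pt_edge S f) [:: Around (mate S f) b].
  by rewrite /is_loop /= /target /= pE !eqxx.
have -> : W d [:: Around (mate S f) false] = W d [:: Around f true].
  case: hrho => _ _; apply; [exact: is_loop_conj (l' _)|exact: is_loop_conj (l _)|].
  exact: (Elem_glue d false (inv_path d) If).
exact: (hol_inv dp (l false)).
Qed.
End Rep.
End Paths.

(** * Irreducibility on the three boundary loops of a pair of pants *)

Section C2.
Variables (H : finType) (S : dual_graph H) (C : numClosedFieldType) (x0 : point H).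
Variable rho : seq (step H) -> 'M[C]_2.
Hypothesis hrho : is_representation S x0 rho.

Lemma realize_inv (D : pants_decomposition H) w :
  (forall s, realize1 D (inv_step s) = inv_path (realize1 D s)) ->
  realize D (inv_path w) = inv_path (realize D w).
Proof.
move=> Ds; elim: w => //= s w IH.
rewrite inv_path_cons realize_cat IH /realize /= cats0 Ds.
by rewrite inv_path_cat.
Qed.

Lemma fixes_mul (A B : 'M[C]_2) x : fixes A x -> fixes B x -> fixes (A *m B) x.
Proof.
move=> [x0' [a Ax]] [_ [b Bx]]; split=> //; exists (b * a).
by rewrite -mulmxA Bx -scalemxAr Ax scalerA.
Qed.

Lemma fixes_inv (A B : 'M[C]_2) x : A *m B = 1%:M -> fixes A x -> fixes B x.
Proof.
move=> /mulmx1C BA [xn0 [a Ax]].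
have E : a *: (B *m x) = x by rewrite scalemxAr -Ax mulmxA BA mul1mx.
have a0 : a != 0 by apply: contraNneq xn0 => a0; rewrite -E a0 scale0r.
split=> //; exists a^-1; apply: (scalerI a0).
by rewrite E scalerA divff // scale1r.
Qed.

(** Fixing a point passes to products and inverses, so a point fixed by the three boundary loops is
    fixed by every word in them. *)
Lemma C2_no_common_fixed_point (D : pants_decomposition H) f d :
  (forall s, realize1 D (inv_step s) = inv_path (realize1 D s)) ->
  (forall h, h \in vertex D f -> is_loop S (pt_edge S f) (realize D (lasso f h))) ->
  condition_C2 S x0 rho D -> is_path S x0 d (pt_edge S f) ->
  no_common_fixed_point (hol rho D d (lasso f f)) (hol rho D d (lasso f (nxt D f)))
    (hol rho D d (lasso f (nxt D (nxt D f)))).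
Proof.
move=> Ds Dl hC2 dp x fx1 fx2 fx3; apply: (hC2 f d dp); exists x.
split; first by case: fx1.
have fx h : h \in vertex D f -> fixes (hol rho D d (lasso f h)) x.
  by rewrite !inE -orbA => /or3P [] /eqP->.
move=> w aw; suff [_ //] : is_loop S (pt_edge S f) (realize D (pants_loop f w)) /\
  fixes (hol rho D d (pants_loop f w)) x.
elim: w aw => [_|[h b] w IH /= /andP [hh /IH [lw fw]]].
  split; first exact: eqxx.
  rewrite -[hol _ _ _ _]/(along rho d [::]) (hol_nil hrho dp).
  by split; [case: fx1 | exists 1; rewrite mul1mx scale1r].
rewrite /pants_loop /= -/(pants_loop f w) /hol realize_cat.
have l1 := Dl h hh; have fh := fx h hh.
set k := (X in realize D X ++ _).
suff [lk fk] : is_loop S (pt_edge S f) (realize D k) /\ fixes (along rho d (realize D k)) x.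
  split; first exact: is_path_cat lk lw.
  rewrite -[rho _]/(along rho d _) (hol_cat hrho dp lk lw); exact: fixes_mul.
rewrite /k; case: b {k} => //=; rewrite realize_inv //; split; first exact: is_path_inv.
exact: fixes_inv (hol_inv hrho dp l1) fh.
Qed.
End C2.

(** * The type (V) move *)

Section Move.
Variables (C : numClosedFieldType) (H : finType) (S : dual_graph H)
  (x0 : point H) (rho : seq (step H) -> 'M[C]_2)
  (f1 f2 f3 f4 f5 : H) (e t e' t' : H -> C) (d : seq (step H)).
Hypothesis hS : dual_graph_axioms S.
Hypothesis hconn : connected S.
Hypothesis hx0 : is_point S x0.
Hypothesis hrho : is_representation S x0 rho.
Hypothesis hf1 : interior S f1.
Hypothesis hout1 : out S f1.
Hypothesis hvv' : vertex S (mate S f1) != vertex S f1.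
Hypothesis hf2 : nxt S f1 = f2.
Hypothesis hf3 : nxt S f2 = f3.
Hypothesis hf4 : nxt S (mate S f1) = f4.
Hypothesis hf5 : nxt S f4 = f5.
Hypothesis hint : all (interior S) [:: f2; f3; f4; f5].
Hypothesis hout : all (out S) [:: f2; f3; f4; f5].
Hypothesis hC1 : condition_C1 S x0 rho (standard S).
Hypothesis hC2 : condition_C2 S x0 rho (standard S).
Hypothesis hC1' : condition_C1 S x0 rho (typeV S f1).
Hypothesis hC2' : condition_C2 S x0 rho (typeV S f1).
Hypothesis he : eigenvalue_parameters S x0 rho (standard S) e.
Hypothesis ht : twist_parameters S x0 rho (standard S) e t.
Hypothesis he' : eigenvalue_parameters S x0 rho (typeV S f1) e'.
Hypothesis hkept : forall h, h \notin edge S f1 -> e' h = e h.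
Hypothesis ht' : twist_parameters S x0 rho (typeV S f1) e' t'.
Hypothesis hd : is_path S x0 d (pt_edge S f1).

Local Notation f1o := (mate S f1).
Local Notation D := (typeV S f1).
Local Notation W := (along rho).
Local Notation curve := (typeV_curve S f1).
(* The half-edges at the two ends of f1; the move does nothing at the others. *)
Let star := [:: f1; f2; f3; f1o; f4; f5].

Let V2 : vertex S f2 = vertex S f1. Proof. by rewrite -hf2 vertex_nxt. Qed.
Let V3 : vertex S f3 = vertex S f1. Proof. by rewrite -hf3 vertex_nxt. Qed.
Let V4 : vertex S f4 = vertex S f1o. Proof. by rewrite -hf4 vertex_nxt. Qed.
Let V5 : vertex S f5 = vertex S f1o. Proof. by rewrite -hf5 vertex_nxt. Qed.
Let nxt3 h : nxt S (nxt S (nxt S h)) = h. Proof. by case: hS. Qed.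
Let hf1' : nxt S f3 = f1. Proof. by rewrite -hf3 -hf2 nxt3. Qed.
Let hf1o : nxt S f5 = f1o. Proof. by rewrite -hf5 -hf4 nxt3. Qed.
Let mateK : involutive (mate S). Proof. by case: hS. Qed.

Lemma star_uniq : uniq star.
Proof.
have nn h : nxt S h != h by case: hS.
have cross a b : vertex S a = vertex S f1 -> vertex S b = vertex S f1o -> a != b.
  by move=> Ea Eb; apply: contraNneq hvv' => ab; rewrite -Eb -ab Ea.
have n12 : f1 != f2 by rewrite eq_sym -hf2 nn.
have n23 : f2 != f3 by rewrite eq_sym -hf3 nn.
have n13 : f1 != f3 by rewrite -{1}hf1' nn.
have no4 : f1o != f4 by rewrite eq_sym -hf4 nn.
have n45 : f4 != f5 by rewrite eq_sym -hf5 nn.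
have no5 : f1o != f5 by rewrite -{1}hf1o nn.
by rewrite /star /= !inE !negb_or n12 n23 n13 no4 n45 no5 !cross.
Qed.

Let neqs : (((f1 == f2) = false) * ((f1 == f3) = false) * ((f1 == f1o) = false) *
  ((f1 == f4) = false) * ((f1 == f5) = false) * ((f2 == f3) = false) *
  ((f2 == f1o) = false) * ((f2 == f4) = false) * ((f2 == f5) = false) *
  ((f3 == f1o) = false) * ((f3 == f4) = false) * ((f3 == f5) = false) *
  ((f1o == f4) = false) * ((f1o == f5) = false) * ((f4 == f5) = false))%type.
Proof.
have := star_uniq; rewrite /star /= !inE !negb_or -!andbA.
case/and5P=> n12 n13 n1o n14 /and5P [n15 n23 n2o n24] /and5P [n25 n3o n34 n35].
by case/and4P=> no4 no5 n45 _; do !split; apply/negbTE.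
Qed.

Let neqs' : (((f2 == f1) = false) * ((f3 == f1) = false) * ((f1o == f1) = false) *
  ((f4 == f1) = false) * ((f5 == f1) = false) * ((f3 == f2) = false) *
  ((f1o == f2) = false) * ((f4 == f2) = false) * ((f5 == f2) = false) *
  ((f1o == f3) = false) * ((f4 == f3) = false) * ((f5 == f3) = false) *
  ((f4 == f1o) = false) * ((f5 == f1o) = false) * ((f5 == f4) = false))%type.
Proof. by do !split; rewrite eq_sym neqs. Qed.

Let nxtD : ((nxt D f1 = f5) * (nxt D f5 = f2) * (nxt D f2 = f1) *
  (nxt D f1o = f3) * (nxt D f3 = f4) * (nxt D f4 = f1o))%type.
Proof. by rewrite /= /typeV_nxt /= !hf2 !hf3 !hf4 !hf5 !neqs !neqs' !eqxx. Qed.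

Let nxtD_off h : h \notin star -> nxt D h = nxt S h.
Proof.
rewrite /star !inE !negb_or => /and5P [/negbTE n1 /negbTE n2 /negbTE n3 /negbTE no].
case/andP=> /negbTE n4 /negbTE n5.
by rewrite /= /typeV_nxt /= !hf2 !hf3 !hf4 !hf5 n1 n2 n3 no n4 n5.
Qed.

Let off_nxt h : h \notin star -> nxt S h \notin star.
Proof.
apply: contra; rewrite -{2}[h]nxt3; move: (nxt S h) => {}h.
by rewrite /star !inE => /or4P [/eqP->|/eqP->|/eqP->|/or3P [] /eqP->];
  rewrite ?hf2 ?hf3 ?hf1' ?hf2 ?hf4 ?hf5 ?hf1o ?hf4 eqxx ?orbT.
Qed.

(** In [star] only [f1o] is incoming, and the mate of an outgoing half is incoming. So the far end
    of an edge other than [f1] is at an unchanged vertex. *)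
Let off_mate f : interior S f -> out S f -> f != f1 -> mate S f \notin star.
Proof.
move=> If Of nf1; case: hS => _ _ _ om; have := om _ If; rewrite Of /= => Om.
case/and5P: hout => o2 o3 o4 o5 _.
rewrite /star !inE !negb_or; apply/and5P; split; last (apply/andP; split);
  try by apply/eqP=> E; move: Om; rewrite E ?hout1 ?o2 ?o3 ?o4 ?o5.
by rewrite (inj_eq (inv_inj mateK)).
Qed.

(** Paths from the base point of [f1], which is also that of [f1o], to those of [f2], ..., [f5]. *)
Let k2 := [:: Along f1 true; Along f2 false].
Let k3 := [:: Along f1 true; Along f3 false].
Let k4 := [:: Along f1o true; Along f4 false].
Let k5 := [:: Along f1o true; Along f5 false].

Let R_inv s : realize1 D (inv_step s) = inv_path (realize1 D s).
Proof.
case: s => h [] /=; rewrite /typeV_realize1 /=; rewrite ?inv_pathK //.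
Qed.

Ltac eval_realize := rewrite /realize /= /typeV_realize1 /= ?hf2 ?hf3 ?hf4 ?hf5
  ?neqs ?neqs' ?eqxx /= ?cats0 /inv_path /typeV_curve /rev /= ?hf2 ?hf3 ?hf4 ?hf5.

(** The realization collapses [Along f1] and [Along f1o], so new loops based at [f1] become words in
    the old lassos without any homotopy, and those based at [f2], ..., [f5] become their conjugates
    by [k2], ..., [k5]. *)
Let r11 : realize D (lasso f1 f1) = curve. Proof. by eval_realize. Qed.
Let r15 : realize D (lasso f1 f5) = lasso f1o f5. Proof. by eval_realize. Qed.
Let r12 : realize D (lasso f1 f2) = lasso f1 f2. Proof. by eval_realize. Qed.
Let roo : realize D (lasso f1o f1o) = inv_path curve. Proof. by eval_realize. Qed.
Let ro3 : realize D (lasso f1o f3) = lasso f1 f3. Proof. by eval_realize. Qed.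
Let ro4 : realize D (lasso f1o f4) = lasso f1o f4. Proof. by eval_realize. Qed.
Let r22 : realize D (lasso f2 f2) = inv_path k2 ++ lasso f1 f2 ++ k2.
Proof. by eval_realize. Qed.
Let r21 : realize D (lasso f2 f1) = inv_path k2 ++ curve ++ k2.
Proof. by eval_realize. Qed.
Let r33 : realize D (lasso f3 f3) = inv_path k3 ++ lasso f1 f3 ++ k3.
Proof. by eval_realize. Qed.
Let r34 : realize D (lasso f3 f4) = inv_path k3 ++ lasso f1o f4 ++ k3.
Proof. by eval_realize. Qed.
Let r44 : realize D (lasso f4 f4) = inv_path k4 ++ lasso f1o f4 ++ k4.
Proof. by eval_realize. Qed.
Let r4o : realize D (lasso f4 f1o) = inv_path k4 ++ inv_path curve ++ k4.
Proof. by eval_realize. Qed.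
Let r55 : realize D (lasso f5 f5) = inv_path k5 ++ lasso f1o f5 ++ k5.
Proof. by eval_realize. Qed.
Let r52 : realize D (lasso f5 f2) = inv_path k5 ++ lasso f1 f2 ++ k5.
Proof. by eval_realize. Qed.

Let roff f h : f \notin star -> h \notin star -> realize D (lasso f h) = lasso f h.
Proof.
rewrite /star !inE !negb_or => /and5P [/negbTE n1 /negbTE n2 /negbTE n3 /negbTE no].
case/andP=> /negbTE n4 /negbTE n5.
case/and5P=> [/negbTE m1 /negbTE m2 /negbTE m3 /negbTE mo] /andP [/negbTE m4 /negbTE m5].
by rewrite /realize /= /typeV_realize1 /= !hf2 !hf3 !hf4 !hf5 n1 n2 n3 no n4 n5 m1 m2 m3 mo m4 m5.
Qed.

Let hdo : is_path S x0 d (pt_edge S f1o).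
Proof. by rewrite /pt_edge edge_mate. Qed.

Let hol_std d0 w : hol rho (standard S) d0 w = W d0 w.
Proof. by rewrite /hol realize_standard. Qed.

Lemma vertex_mem f h : h \in vertex S f -> vertex S h = vertex S f.
Proof. by rewrite !inE -orbA => /or3P [] /eqP->; rewrite ?vertex_nxt. Qed.

(** (C1) and the eigenvalue condition concern [Around h] at the edge of [h]; they are transported to
    the edge of [f] through the common vertex. *)
Lemma lasso_regular f h d0 : is_path S x0 d0 (pt_edge S f) -> vertex S h = vertex S f ->
  [/\ \det (W d0 (lasso f h)) = 1, eigenvalue (W d0 (lasso f h)) (e h) & e h != (e h)^-1].
Proof.
move=> dp Vh; have dW := hol_det hrho dp (is_loop_lasso Vh).
set k := [:: Along f true; Along h false].
have pk : is_path S (pt_edge S f) k (pt_edge S h).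
  by rewrite /= /target /= /pt_vertex Vh !eqxx.
have dk := is_path_cat dp pk.
have := hC1 dk; have := he.2 h _ dk; rewrite !hol_std -hol_lasso_around => ee c1.
by split=> //; apply: regular_eigenvalue dW c1 ee.
Qed.

Lemma std_irreducible f d0 : is_path S x0 d0 (pt_edge S f) ->
  no_common_fixed_point (W d0 (lasso f f)) (W d0 (lasso f (nxt S f)))
    (W d0 (lasso f (nxt S (nxt S f)))).
Proof.
move=> dp; rewrite -!hol_std.
apply: (C2_no_common_fixed_point hrho (D := standard S)) dp => //.
by move=> h /vertex_mem Vh; rewrite realize_standard; apply: is_loop_lasso.
Qed.

Lemma half_regular f h d0 : is_path S x0 d0 (pt_edge S f) -> vertex S h = vertex S f ->
  half_parameter (standard S) e h != (half_parameter (standard S) e h)^-1 /\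
  exists q, eigenvector (W d0 (lasso f h)) (half_parameter (standard S) e h) q.
Proof.
move=> dp Vh; have [dW ee eV] := lasso_regular dp Vh.
have [ex ex'] := eigenvector_exists dW ee.
rewrite /half_parameter /=; case: (out S h) => //.
by split=> //; apply: inv_neq_inv.
Qed.

Let half_off h : h \notin star -> half_parameter D e' h = half_parameter (standard S) e h.
Proof.
move=> hs; rewrite /half_parameter /= hkept //.
by apply: contra hs; rewrite /star !inE => /orP [] /eqP->; rewrite eqxx ?orbT.
Qed.

(* Both twist parameters compare the same target point q beyond the far end of f. *)
Lemma twist_change f d0 (A B B' : 'M[C]_2) (X Y p p' : 'cV[C]_2) :
  interior S f -> out S f -> f != f1 -> is_path S x0 d0 (pt_edge S f) ->
  W d0 (lasso f f) = A -> W d0 (realize D (lasso f f)) = A ->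
  W d0 (lasso f (nxt S f)) = B -> W d0 (realize D (lasso f (nxt D f))) = B' ->
  \det B = 1 -> \det B' = 1 ->
  half_parameter (standard S) e (nxt S f) != (half_parameter (standard S) e (nxt S f))^-1 ->
  half_parameter D e' (nxt D f) != (half_parameter D e' (nxt D f))^-1 ->
  eigenvector A (e f) X -> eigenvector A (e f)^-1 Y ->
  eigenvector B (half_parameter (standard S) e (nxt S f)) p ->
  eigenvector B' (half_parameter D e' (nxt D f)) p' ->
  br X p != 0 -> br X p' != 0 ->
  t' f * ratio X Y p' = t f * ratio X Y p.
Proof.
move=> If Of nf1 dp EA EA' EB EB' dB dB' bV b'V eX eY ep ep' Xp Xp'.
have gs := off_mate If Of nf1; set g := mate S f in gs.
have pg : is_path S x0 d0 (pt_edge S g) by rewrite /pt_edge edge_mate.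
set h5 := nxt S (nxt S g).
have Vh5 : vertex S h5 = vertex S g by rewrite !vertex_nxt.
have [dA _ aV] := lasso_regular dp (erefl (vertex S f)); rewrite EA in dA.
have [dG _ _] := lasso_regular pg Vh5; have [cV [q eq]] := half_regular pg Vh5.
have hf5' : h5 \notin star by rewrite !off_nxt.
have ef : e' f = e f.
  apply: hkept; rewrite !inE negb_or nf1 /=; apply/eqP=> ff.
  by case: hS => _ _ _ om; have := om _ hf1; rewrite -ff Of hout1.
have [t0 /(_ _ dp)] := ht If Of; rewrite !hol_std EA EB -/g -/h5 => T.
have [t0' /(_ _ dp)] := ht' If Of.
rewrite [mate D f]/(mate S f) -/g (nxtD_off gs) (nxtD_off (off_nxt gs)) -/h5.
rewrite /hol (roff gs hf5') (half_off hf5') ef.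
rewrite -!/(along rho _ _) EA' EB' => T'.
apply: (twist_compare (eigenvector_br eX eY aV) (proj1 eq) Xp Xp').
  exact: (twist_br dA dB dG aV bV cV t0 T eX eY ep eq).
exact: (twist_br dA dB' dG aV b'V cV t0' T' eX eY ep' eq).
Qed.

(** Both ends of [f] are unchanged vertices, so [twist_change] applies with the same point on both
    sides. *)
Lemma twist_other f : interior S f -> out S f -> f \notin [:: f1; f2; f3; f4; f5] ->
  t' f = t f.
Proof.
move=> If Of; rewrite !inE !negb_or => /and5P [n1 n2 n3 n4 n5].
have no : f != f1o.
  by apply/eqP=> ff; case: hS => _ _ _ om; have := om _ hf1; rewrite -ff Of hout1.
have fs : f \notin star by rewrite /star !inE !negb_or n1 n2 n3 no n4 n5.
(* Without a path from [x0] to [f] the twist condition would be vacuous. *)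
have [d0 dp] : exists w, is_path S x0 w (pt_edge S f).
  by apply: hconn => //; exists f; right.
have Vn : vertex S (nxt S f) = vertex S f by rewrite vertex_nxt.
have [dA eA aV] := lasso_regular dp (erefl (vertex S f)).
have [[X eX] [Y eY]] := eigenvector_exists dA eA.
have [dB _ _] := lasso_regular dp Vn; have [bV [p ep]] := half_regular dp Vn.
have Xp := pants_br_neq0 (hol_lasso_prod hS hrho dp) (std_irreducible dp) eX ep.
have Yp := pants_br_neq0 (hol_lasso_prod hS hrho dp) (std_irreducible dp) eY ep.
have R0 : ratio X Y p != 0 by rewrite /ratio mulf_neq0 ?invr_eq0.
apply: (mulIf R0).
apply: (twist_change (d0 := d0) If Of n1 dp (erefl _) _ (erefl _) _ dB dB bV _ eX eY ep);
  by rewrite ?(nxtD_off fs) ?roff ?half_off // off_nxt.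
Qed.

Let loop_curve : is_loop S (pt_edge S f1) curve.
Proof.
rewrite /typeV_curve hf2 hf3 hf4; apply: is_path_cat (is_loop_lasso V3) _.
by have := is_loop_lasso V4; rewrite /is_loop /pt_edge edge_mate.
Qed.

Lemma move_eigenvalue : eigenvalue (W d curve) (e' f1).
Proof.
have := he'.2 f1 d hd; rewrite /hol /realize /= eqxx cats0; exact.
Qed.

(** For each of [f2], ..., [f5] the point compared is the fixed point on the next half-edge. The
    move replaces [f3] by [f1] after [f2], [f1] by [f4] after [f3], [f5] by [f1o] after [f4], and
    [f1o] by [f2] after [f5]. *)
Lemma move_config : exists x1 y1 x2 y2 x3 y3 x4 y4 x5 y5 xP yP : 'cV[C]_2,
  flip_config (W d (lasso f1 f1)) (W d (lasso f1o f1o)) (W d (lasso f1 f2))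
    (W d (lasso f1 f3)) (W d (lasso f1o f4)) (W d (lasso f1o f5))
    (W d curve) (W d (inv_path curve)) (e f1) (e f2) (e f3) (e f4) (e f5) (e' f1) (t f1)
    x1 y1 x2 y2 x3 y3 x4 y4 x5 y5 xP yP /\
  [/\ ratio xP yP x4 = - t' f1 * ratio xP yP x5,
      t' f2 * ratio x2 y2 xP = t f2 * ratio x2 y2 x3,
      t' f3 * ratio x3 y3 x4 = t f3 * ratio x3 y3 x1,
      t' f4 * ratio x4 y4 xP = t f4 * ratio x4 y4 x5
    & t' f5 * ratio x5 y5 x2 = t f5 * ratio x5 y5 x1].
Proof.
case/and5P: hint => i2 i3 i4 i5 _; case/and5P: hout => o2 o3 o4 o5 _.
have oo : out S f1o = false by case: hS => _ _ _ om; rewrite om // hout1.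
have Eo : e f1o = e f1 by case: he => em _; exact: em.
have Eo' : e' f1o = e' f1 by case: he' => em _; exact: em.
have pE : pt_edge S f1o = pt_edge S f1 by rewrite /pt_edge edge_mate.
have hstar f : f != f1 -> f != f1o -> e' f = e f.
  by move=> n1 no; rewrite hkept // !inE negb_or n1 no.
have e2 : e' f2 = e f2 by rewrite hstar // ?neqs ?neqs'.
have e3 : e' f3 = e f3 by rewrite hstar // ?neqs ?neqs'.
have e4 : e' f4 = e f4 by rewrite hstar // ?neqs ?neqs'.
have e5 : e' f5 = e f5 by rewrite hstar // ?neqs ?neqs'.
have [d1 q1 v1] := lasso_regular hd (erefl (vertex S f1)).
have [d1o _ _] := lasso_regular hdo (erefl (vertex S f1o)).
have [d2 q2 v2] := lasso_regular hd V2; have [d3 q3 v3] := lasso_regular hd V3.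
have [d4 q4 v4] := lasso_regular hdo V4; have [d5 q5 v5] := lasso_regular hdo V5.
have dP := hol_det hrho hd loop_curve.
have dPo := hol_det hrho hd (is_path_inv loop_curve).
have qP := move_eigenvalue.
have vP : e' f1 != (e' f1)^-1.
  apply: regular_eigenvalue dP _ qP; have := hC1' hd.
  by rewrite /hol /realize /= eqxx cats0; exact.
have [[x1 ex1] [y1 ey1]] := eigenvector_exists d1 q1.
have [[x2 ex2] [y2 ey2]] := eigenvector_exists d2 q2.
have [[x3 ex3] [y3 ey3]] := eigenvector_exists d3 q3.
have [[x4 ex4] [y4 ey4]] := eigenvector_exists d4 q4.
have [[x5 ex5] [y5 ey5]] := eigenvector_exists d5 q5.
have [[xP exP] [yP eyP]] := eigenvector_exists dP qP.
have G11o : W d (lasso f1 f1) *m W d (lasso f1o f1o) = 1%:M.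
  by rewrite (hol_lasso_self hrho hd) (hol_lasso_self hrho hdo) (hol_glue hS hrho hf1 hd).
have PPo := hol_inv hrho hd loop_curve.
have := hol_lasso_prod hS hrho hd; rewrite hf2 hf3 => G123.
have := hol_lasso_prod hS hrho hdo; rewrite hf4 hf5 => Go45.
have L4 : is_loop S (pt_edge S f1) (lasso f1o f4).
  by have := is_loop_lasso V4; rewrite pE.
have L5 : is_loop S (pt_edge S f1) (lasso f1o f5).
  by have := is_loop_lasso V5; rewrite pE.
have L2 := is_loop_lasso V2; have L3 := is_loop_lasso V3.
have defP : W d curve = W d (lasso f1 f3) *m W d (lasso f1o f4).
  by rewrite /typeV_curve hf2 hf3 hf4 (hol_cat hrho hd L3 L4).
have := std_irreducible hd; rewrite hf2 hf3 => irr1.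
have := std_irreducible hdo; rewrite hf4 hf5 => irr1o.
have irrP : no_common_fixed_point (W d curve) (W d (lasso f1o f5)) (W d (lasso f1 f2)).
  have := C2_no_common_fixed_point hrho (f := f1) R_inv _ hC2' hd.
  rewrite !nxtD /hol r11 r15 r12; apply=> h.
  by rewrite !inE !nxtD -orbA => /or3P [] /eqP->; rewrite ?r11 ?r15 ?r12.
have irrPo : no_common_fixed_point (W d (inv_path curve)) (W d (lasso f1 f3)) (W d (lasso f1o f4)).
  have := C2_no_common_fixed_point hrho (f := f1o) R_inv _ hC2' hdo.
  rewrite !nxtD /hol roo ro3 ro4; apply=> h.
  rewrite !inE !nxtD -orbA pE => /or3P [] /eqP->; rewrite ?roo ?ro3 ?ro4 //.
  exact: is_path_inv.
have half0 f : out S f -> half_parameter (standard S) e f = e f by rewrite /half_parameter /= => ->.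
have half1 f : out S f -> half_parameter D e' f = e' f by rewrite /half_parameter /= => ->.
(* On the incoming half both the loop and the eigenvalue are inverted, so the fixed point is again
   [x1], respectively [xP]. *)
have halfo : half_parameter (standard S) e f1o = (e f1)^-1.
  by rewrite /half_parameter /= oo Eo.
have halfo1 : half_parameter D e' f1o = (e' f1)^-1.
  by rewrite /half_parameter /= oo Eo'.
have TW1 : br y1 x5 * br x1 x2 = - t f1 * br y1 x2 * br x1 x5.
  have [t0 /(_ _ hd)] := ht hf1 hout1.
  rewrite !hol_std [nxt _ _]hf2 [mate _ _]/(f1o) [nxt _ f1o]hf4 [nxt _ f4]hf5 !half0 // => T.
  exact: (twist_br d1 d2 d5 v1 v2 v5 t0 T ex1 ey1 ex2 ex5).
have TWP : br yP x4 * br xP x5 = - t' f1 * br yP x5 * br xP x4.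
  have [t0 /(_ _ hd)] := ht' hf1 hout1.
  rewrite [mate _ _]/(f1o) !nxtD /hol r11 r15 ro4 !half1 // e5 e4 => T.
  exact: (twist_br dP d5 d4 vP v5 v4 t0 T exP eyP ex5 ex4).
have eo1 := eigenvector_inv G11o (neq_inv_neq0 v1) ex1.
have eoP := eigenvector_inv PPo (neq_inv_neq0 vP) exP.
have x12 := pants_br_neq0 G123 irr1 ex1 ex2.
have x15 := pants_br_neq0_ac Go45 irr1o eo1 ex5.
exists x1, y1, x2, y2, x3, y3, x4, y4, x5, y5, xP, yP.
set cfg := (X in X /\ _).
have cf : cfg by split=> //; exact: (twist_ratio x12 x15 TW1).
split=> //.
have P52 := flip_P52 cf; have irr52P := irreducible_rot irrP.
have G52P := pants_rot P52; have G2P5 := pants_rot G52P.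
have irr2P5 := irreducible_rot irr52P.
have Po34 := flip_Po34 cf; have irr34o := irreducible_rot irrPo.
have G34o := pants_rot Po34; have G4o3 := pants_rot G34o.
have irr4o3 := irreducible_rot irr34o.
have G231 := pants_rot G123; have irr231 := irreducible_rot irr1.
have G45o := pants_rot Go45; have irr45o := irreducible_rot irr1o.
have xP5 := pants_br_neq0 P52 irrP exP ex5.
have xP4 := pants_br_neq0_ac Po34 irrPo eoP ex4.
have path_spoke f h : vertex S h = vertex S f ->
    is_path S (pt_edge S f) [:: Along f true; Along h false] (pt_edge S h).
  by move=> Vh; rewrite /= /target /= /pt_vertex Vh !eqxx.
have p2 := path_spoke _ _ V2; have p3 := path_spoke _ _ V3.
have := path_spoke _ _ V4; rewrite pE => p4.
have := path_spoke _ _ V5; rewrite pE => p5.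
have Lo := is_path_inv loop_curve.
split.
- exact: (twist_ratio xP5 xP4 TWP).
- have x23 := pants_br_neq0 G231 irr231 ex2 ex3.
  have x2P := pants_br_neq0 G2P5 irr2P5 ex2 exP.
  apply: (twist_change (d0 := d ++ k2) (A := W d (lasso f1 f2)) (B := W d (lasso f1 f3))
    (B' := W d curve) i2 o2 _ (is_path_cat hd p2) _ _ _ _ d3 dP _ _ ex2 ey2 _ _ x23 x2P);
    rewrite ?hf3 ?nxtD ?half0 ?half1 ?neqs' //.
  + exact: (hol_lasso_change hrho hd V2 V2).
  + by rewrite r22; apply: (hol_conj hrho hd p2 L2).
  + exact: (hol_lasso_change hrho hd V2 V3).
  + by rewrite r21; apply: (hol_conj hrho hd p2 loop_curve).
- have x31 : br x3 x1 != 0 by rewrite brC oppr_eq0; exact: (pants_br_neq0_ac G123 irr1 ex1 ex3).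
  have x34 := pants_br_neq0 G34o irr34o ex3 ex4.
  apply: (twist_change (d0 := d ++ k3) (A := W d (lasso f1 f3)) (B := W d (lasso f1 f1))
    (B' := W d (lasso f1o f4)) i3 o3 _ (is_path_cat hd p3) _ _ _ _ d1 d4 _ _ ex3 ey3 _ _ x31 x34);
    rewrite ?hf1' ?nxtD ?half0 ?half1 ?neqs' ?e4 //.
  + exact: (hol_lasso_change hrho hd V3 V3).
  + by rewrite r33; apply: (hol_conj hrho hd p3 L3).
  + exact: (hol_lasso_change hrho hd V3 (erefl _)).
  + by rewrite r34; apply: (hol_conj hrho hd p3 L4).
- have x45 := pants_br_neq0 G45o irr45o ex4 ex5.
  have x4P := pants_br_neq0 G4o3 irr4o3 ex4 eoP.
  apply: (twist_change (d0 := d ++ k4) (A := W d (lasso f1o f4)) (B := W d (lasso f1o f5))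
    (B' := W d (inv_path curve)) i4 o4 _ (is_path_cat hd p4) _ _ _ _ d5 dPo _ _ ex4 ey4 _ _ x45 x4P);
    rewrite ?hf5 ?nxtD ?half0 ?halfo1 ?neqs' ?inv_neq_inv //.
  + exact: (hol_lasso_change hrho hdo V4 V4).
  + by rewrite r44; apply: (hol_conj hrho hd p4 L4).
  + exact: (hol_lasso_change hrho hdo V4 V5).
  + by rewrite r4o; apply: (hol_conj hrho hd p4 Lo).
- have x51 : br x5 x1 != 0 by rewrite brC oppr_eq0.
  have x52 := pants_br_neq0 G52P irr52P ex5 ex2.
  apply: (twist_change (d0 := d ++ k5) (A := W d (lasso f1o f5)) (B := W d (lasso f1o f1o))
    (B' := W d (lasso f1 f2)) i5 o5 _ (is_path_cat hd p5) _ _ _ _ d1o d2 _ _ ex5 ey5 _ _ x51 x52);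
    rewrite ?hf1o ?nxtD ?halfo ?half1 ?neqs' ?e2 ?inv_neq_inv //.
  + exact: (hol_lasso_change hrho hdo V5 V5).
  + by rewrite r55; apply: (hol_conj hrho hd p5 L5).
  + exact: (hol_lasso_change hrho hdo V5 (erefl _)).
  + by rewrite r52; apply: (hol_conj hrho hd p5 L2).
Qed.
End Move.

Theorem proposition10p8 (R : realType) (H : finType) (S : dual_graph H)
  (x0 : point H) (rho : seq (step H) -> 'M[R[i]]_2)
  (f1 f2 f3 f4 f5 : H) (e t e' t' : H -> R[i]) (d : seq (step H))
  (hS : dual_graph_axioms S) (hconn : connected S) (hx0 : is_point S x0)
  (hrho : is_representation S x0 rho)
  (hf1 : interior S f1) (hout1 : out S f1)
  (hvv' : vertex S (mate S f1) != vertex S f1)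
  (hf2 : nxt S f1 = f2) (hf3 : nxt S f2 = f3)
  (hf4 : nxt S (mate S f1) = f4) (hf5 : nxt S f4 = f5)
  (hint : all (interior S) [:: f2; f3; f4; f5])
  (hout : all (out S) [:: f2; f3; f4; f5])
  (huniq : uniq [seq edge S f | f <- [:: f2; f3; f4; f5]])
  (hC1 : condition_C1 S x0 rho (standard S))
  (hC2 : condition_C2 S x0 rho (standard S))
  (hC1' : condition_C1 S x0 rho (typeV S f1))
  (hC2' : condition_C2 S x0 rho (typeV S f1))
  (he : eigenvalue_parameters S x0 rho (standard S) e)
  (ht : twist_parameters S x0 rho (standard S) e t)
  (he' : eigenvalue_parameters S x0 rho (typeV S f1) e')
  (hkept : forall h, h \notin edge S f1 -> e' h = e h)
  (ht' : twist_parameters S x0 rho (typeV S f1) e' t')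
  (hd : is_path S x0 d (pt_edge S f1)) :
  let g2 := lasso f1 f2 in
  let g3 := lasso f1 f3 in
  let g4 := lasso (mate S f1) f4 in
  let g5 := lasso (mate S f1) f5 in
  let tr34 := \tr (hol rho (standard S) d (g3 ++ g4)) in
  let tr24 := \tr (hol rho (standard S) d (g2 ++ g4)) in
  let tr35 := \tr (hol rho (standard S) d (g3 ++ g5)) in
  let e1 := e f1 in let e2 := e f2 in let e3 := e f3 in
  let e4 := e f4 in let e5 := e f5 in
  let t1 := t f1 in
  let E := e' f1 in
  let s1 := e1 + e1^-1 in let s2 := e2 + e2^-1 in let s3 := e3 + e3^-1 in
  let s4 := e4 + e4^-1 in let s5 := e5 + e5^-1 in
  let K := (e2 * e3 - e1) * (e1 * e3 - e2) / (e1 * e2 * e3)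
           * ((e4 * e5 - e1) * (e1 * e4 - e5) / (e1 * e4 * e5)) in
  let L := (1 - e1 * e2 * e3) * (e1 * e2 - e3) / (e1 * e2 * e3)
           * ((1 - e1 * e4 * e5) * (e1 * e5 - e4) / (e1 * e4 * e5)) in
  (E ^+ 2 - tr34 * E + 1 = 0)
  /\
  (E ^+ 2 != -1 ->
   t' f1 = 1 / (E + E^-1)
     * (E * e5 * e2 / ((e5 * e2 - E) * (E * e2 - e5)))
     * (E * e3 * e4 / ((e3 * e4 - E) * (E * e3 - e4)))
     * ((E - E^-1) * (E * tr35 - E^-1 * tr24)
        - (E + E^-1) * (s2 * s3 + s4 * s5)
        + 2 * (s3 * s5 + s2 * s4)))
  /\
  (t' f1 =
     ((e4 * E - e3)
      * (e3 * e5 * (- (e1 * e3 - e2) * t1 + e1 * (e1 * e2 - e3)) * E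
         + e1 * (e1 * e3 - e2) * t1 - (e1 * e2 - e3)))
     / ((e3 * E - e4)
        * ((e1 * (e1 * e3 - e2) * t1 - (e1 * e2 - e3)) * E
           + e3 * e5 * (- (e1 * e3 - e2) * t1 + e1 * (e1 * e2 - e3)))))
  /\
  (t' f2 =
     (e1 * e2 - e3) * (e1 * e3 - e2) * (t1 + 1)
     / ((e2 * e3 - e1) * (e1 * e3 - e2) * t1
        + (1 - e1 * e2 * e3) * (e1 * e2 - e3))
     * ((e2 * E - e5) / (e2 * e5 - E)) * t f2)
  /\
  (t' f3 =
     (e2 * e3 - e1) * ((e1 * e3 - e2) * (e1 * e4 - e5) * t1
                       + (e1 * e2 - e3) * (e1 * e5 - e4))
     / ((e1 * e3 - e2) * ((e2 * e3 - e1) * (e1 * e4 - e5) * t1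
                          + (1 - e1 * e2 * e3) * (e1 * e5 - e4)))
     * t f3)
  /\
  (t' f4 =
     ((e1 * e3 - e2) * (e1 * e4 - e5) * t1 + (e1 * e2 - e3) * (e1 * e5 - e4))
     / ((e1 * e3 - e2) * (e4 * e5 - e1) * t1
        + (e1 * e2 - e3) * (1 - e1 * e4 * e5))
     * ((e3 * E - e4) / (1 - e3 * e4 * E)) * t f4)
  /\
  (t' f5 =
     (e1 * e5 - e4) * (e1 * e4 * e5 - 1) * (t1 + 1)
     / ((e1 - e4 * e5) * (e1 * e4 - e5) * t1
        + (e1 * e4 * e5 - 1) * (e1 * e5 - e4))
     * t f5)
  /\
  (forall f, interior S f -> out S f -> f \notin [:: f1; f2; f3; f4; f5] ->
     t' f = t f)
  /\
  [/\ (e1 - e1^-1) ^+ 2 * tr34 =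
        - K * t1 - L * t1^-1
        + s1 * (s3 * s5 + s2 * s4) - 2 * (s2 * s5 + s3 * s4),
      (e1 - e1^-1) ^+ 2 * tr24 =
        K * (e1 * t1) + L * (e1 * t1)^-1
        + s1 * (s2 * s5 + s3 * s4) - 2 * (s2 * s4 + s3 * s5)
    & (e1 - e1^-1) ^+ 2 * tr35 =
        K * e1^-1 * t1 + L * e1 * t1^-1
        + s1 * (s2 * s5 + s3 * s4) - 2 * (s2 * s4 + s3 * s5)].
Proof.
move=> g2 g3 g4 g5 tr34 tr24 tr35 e1 e2 e3 e4 e5 t1 E s1 s2 s3 s4 s5 K L.
have [x1 [y1 [x2 [y2 [x3 [y3 [x4 [y4 [x5 [y5 [xP [yP [cfg [h1 h2 h3 h4 h5]]]]]]]]]]]]]] :=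
  move_config hS hrho hf1 hout1 hvv' hf2 hf3 hf4 hf5 hint hout hC1 hC2 hC1' hC2' he ht he' hkept ht' hd.
have pE : pt_edge S (mate S f1) = pt_edge S f1 by rewrite /pt_edge edge_mate.
have V2 : vertex S f2 = vertex S f1 by rewrite -hf2 vertex_nxt.
have V3 : vertex S f3 = vertex S f1 by rewrite -hf3 vertex_nxt.
have V4 : vertex S f4 = vertex S (mate S f1) by rewrite -hf4 vertex_nxt.
have V5 : vertex S f5 = vertex S (mate S f1) by rewrite -hf5 vertex_nxt.
have L2 := is_loop_lasso V2; have L3 := is_loop_lasso V3.
have := is_loop_lasso V4; have := is_loop_lasso V5; rewrite pE => L5 L4.
have holM u v : is_loop S (pt_edge S f1) u -> is_loop S (pt_edge S f1) v ->
    hol rho (standard S) d (u ++ v) = along rho d u *m along rho d v.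
  by move=> lu lv; rewrite /hol realize_standard -(hol_cat hrho hd lu lv).
have tr34E : tr34 = \tr (along rho d g3 *m along rho d g4) by rewrite /tr34 holM.
have tr24E : tr24 = \tr (along rho d g2 *m along rho d g4) by rewrite /tr24 holM.
have tr35E : tr35 = \tr (along rho d g3 *m along rho d g5) by rewrite /tr35 holM.
rewrite tr34E tr24E tr35E; split.
  have [dP _ _ _] := flip_pairP cfg; rewrite -(flip_defP cfg).
  exact: (eigenvalue_char dP (move_eigenvalue he' hd)).
split; first exact: (flip_t1_trace cfg h1).
split; first exact: (flip_t1 cfg h1).
split; first exact: (flip_t2 cfg h2).
split; first exact: (flip_t3 cfg h3).
split; first exact: (flip_t4 cfg h4).
split; first exact: (flip_t5 cfg h5).
split; last exact: (flip_traces cfg).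
move=> f If Of nf.
exact: (twist_other hS hconn hx0 hrho hf1 hout1 hf2 hf3 hf4 hf5 hout hC1 hC2 he ht hkept ht').
Qed.
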